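(* Let $p\in(0,1]$, $s\in[p,2]$, $P=\lfloor p^{-1}-1\rfloor$, and let $X\subset\mathbb{R}$ be an open interval (possibly unbounded) with $(0,c)\subset X$ for some $c>0$. Let $\{\varphi_k\}_{k\in\mathbb{N}}$ be an orthonormal basis of $L^2(X)$ with $\varphi_k\in\Lambda_{\frac1p-1}(X)$ for every $k$. For $r\in(0,1)$ let $R_rf=\sum_{k\in\mathbb{N}}r^k\langle f,\varphi_k\rangle\varphi_k$, and assume that $R_r$ is an integral operator, $R_rf(y)=\int_XR_r(x,y)f(x)\,dx$, whose kernel is of class $\mathcal{C}^P(X)$ in $x$ for every $y\in X$, and that there exist $\gamma>0$ and a finite set $\Delta$ of positive numbers, each strictly greater than $p^{-1}-1-P$, such that for each $k=0,\ldots,P$ there is a constant $C_k$ with $$\Big\|R_r(x,\cdot)-\sum_{i=0}^k\frac{\partial_x^iR_r(x',\cdot)}{i!}(x-x')^i\Big\|_{L^2(X)}\le C_k\sum_{\delta\in\Delta}(1-r)^{-(1+2k+2\delta)\gamma}|x-x'|^{k+\delta}$$ for all $r\in(0,1)$ and $x,x'\in X$ with $|x-x'|\le1/2$. Assume moreover that the functions $\varphi_k$ are $(P+1)$-times differentiable and that there exist $\tau>\frac{4\gamma-2p\gamma-p}{2p}$ and constants $0<m\le M$ such that $$m(k+1)^\tau u^{\frac{1+2\tau-2\gamma}{4\gamma}-(P+1)}\le|\varphi_k^{(P+1)}(u)|\le M(k+1)^\tau u^{\frac{1+2\tau-2\gamma}{4\gamma}-(P+1)}$$ for all $K\in\mathbb{N}$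 with $K\ge1$, all $0\le k\le K$ and all $u\in(0,cK^{-2\gamma})$, and that $\varphi_k^{(P+1)}$ does not change sign on this interval. Set $$E=\frac{(2-p)s\gamma}{p}+\frac{2-s}{2}.$$ Then the exponent $E$ in the inequality $$\sum_{k\in\mathbb{N}}\frac{|\langle f,\varphi_k\rangle|^s}{(k+1)^E}\lesssim\|f\|_{H^p(X)}^s,\qquad f\in H^p(X),$$ cannot be lowered; that is, for every $\varepsilon>0$ there is no constant $C$ such that $\sum_{k\in\mathbb{N}}|\langle f,\varphi_k\rangle|^s(k+1)^{-(E-\varepsilon)}\le C\|f\|^s_{H^p(X)}$ for all $f\in H^p(X)$.
   Context: $\mathbb{N}=\{0,1,2,\ldots\}$. $X$ carries Lebesgue measure. Hardy spaces. For $p\in(0,1]$, $H^p(\mathbb{R})$ is the real Hardy space of distributions $f$ with $\sup_{t>0}|f*\Phi_t|\in L^p(\mathbb{R})$, where $\Phi$ is a fixed Schwartz function with $\int\Phi\ne0$, $\Phi_t(x)=t^{-1}\Phi(x/t)$. For $q\in[1,\infty]$, $q>p$, a $(p,q)$-atom is a measurable function $a$ supported in a bounded interval $B$ with $\|a\|_{L^q}\le|B|^{1/q-1/p}$ and $\int_Ba(x)x^i\,dx=0$ for $0\le i\le\lfloor p^{-1}-1\rfloor$. $H^p(X)$ is the set of all $f=F|_X$ with $F\in H^p(\mathbb{R})$, $\mathrm{supp}\,F\subset\overline X$; each such $f$ can be written $f=\sum_j\lambda_ja_j$ with atoms $a_j$ supported in $X$ and $\sum_j|\lambda_j|^p<\infty$,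 and $\|f\|_{H^p(X)}=\inf(\sum_j|\lambda_j|^p)^{1/p}$ over such decompositions (different $q$ give equivalent quantities). Lipschitz spaces. For $\nu>0$, $\nu\notin\mathbb{N}$, $\Lambda_\nu(\mathbb{R})$ consists of bounded $g\in\mathcal{C}^{\lfloor\nu\rfloor}(\mathbb{R})$ with $\sup_{x,h}|g^{(\lfloor\nu\rfloor)}(x+h)-g^{(\lfloor\nu\rfloor)}(x)|/|h|^{\nu-\lfloor\nu\rfloor}<\infty$; for integer $\nu\ge1$, of bounded $g\in\mathcal{C}^{\nu-1}(\mathbb{R})$ with $\sup_{x,h}|g^{(\nu-1)}(x+h)-2g^{(\nu-1)}(x)+g^{(\nu-1)}(x-h)|/|h|<\infty$ ($h\ne0$); $\Lambda_0(\mathbb{R})=BMO(\mathbb{R})$. $\Lambda_\nu(X)$ is the space of restrictions to $X$ of elements of $\Lambda_\nu(\mathbb{R})$. Pairing. $\langle f,\varphi_k\rangle=\int_Xf\overline{\varphi_k}\,dx$ whenever this makes sense; for general $f\in H^p(X)$ it is the value at $f$ of the bounded linear functional on $H^p(X)$ given by the $H^p$–$\Lambda_{1/p-1}$ duality, i.e. $\sum_j\lambda_j\int_Xa_j\overline{\varphi_k}\,dx$ for an atomic decomposition $f=\sum_j\lambda_ja_j$ with atoms supported in $X$. *)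

(* Defs.v *)
From HB Require Import structures.
From mathcomp Require Import all_boot all_order all_algebra.
From mathcomp Require Import finmap complex.
From mathcomp Require Import all_classical all_reals all_analysis.

Set Implicit Arguments.
Unset Strict Implicit.
Unset Printing Implicit Defensive.

Import Order.TTheory GRing.Theory Num.Theory.
Import numFieldNormedType.Exports.

Local Open Scope classical_set_scope.
Local Open Scope ring_scope.
Local Open Scope complex_scope.

(* Functions are complex-valued, on the real line or on a subset X of it; a
   function on X is a total function of which only the values on X are used. *)

Notation normc := ComplexField.Normc.normc.

Section ComplexValued.
Variable R : realType.
Implicit Types (D X : set R) (f g : R -> R[i]) (n : nat).

Notation mu := (@lebesgue_measure R).

Definition rpart f : R -> R := fun x => complex.Re (f x).
Definition ipart f : R -> R := fun x => complex.Im (f x).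

Definition cconv (u : nat -> R[i]) (l : R[i]) : Prop :=
  (fun n => normc (u n - l)) @ \oo --> (0 : R).

Definition cmeasurable D f : Prop :=
  measurable_fun D (rpart f) /\ measurable_fun D (ipart f).

Definition cintegrable D f : Prop :=
  mu.-integrable D (EFin \o rpart f) /\ mu.-integrable D (EFin \o ipart f).

Definition cintegral D f : R[i] :=
  (\int[mu]_(x in D) rpart f x) +i* (\int[mu]_(x in D) ipart f x).

Definition cderiven n f : R -> R[i] :=
  fun x => (derive1n n (rpart f) x) +i* (derive1n n (ipart f) x).

(* The next two notions are meant for an open set X. *)
Definition ndifferentiable X n f : Prop :=
  forall i, (i < n)%N -> forall x, X x ->
    derivable (derive1n i (rpart f)) x 1 /\
    derivable (derive1n i (ipart f)) x 1.

Definition class_C X n f : Prop :=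
  ndifferentiable X n f /\
  forall x, X x ->
    {for x, continuous (derive1n n (rpart f))} /\
    {for x, continuous (derive1n n (ipart f))}.

Definition L2norm X f : \bar R :=
  ((\int[mu]_(x in X) ((normc (f x)) ^+ 2)%:E) `^ (2^-1))%E.

Definition in_L2 X f : Prop := cmeasurable X f /\ (L2norm X f < +oo)%E.

Definition inner X f g : R[i] := cintegral X (fun x => f x * (g x)^*).

Definition orthonormal_basis X (phi : nat -> R -> R[i]) : Prop :=
  [/\ forall k, in_L2 X (phi k),
      forall j k, inner X (phi j) (phi k) = (j == k)%:R
    & forall f, in_L2 X f ->
      (fun n => L2norm X (fun x =>
         f x - \sum_(k < n) inner X f (phi k) * phi k x)) @ \oo --> 0%E].

(* The order of R[i] relates only numbers with the same imaginary part, so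
   this says that g is real on D and of constant sign there. *)
Definition constant_sign D g : Prop :=
  (forall x, D x -> 0 <= g x) \/ (forall x, D x -> g x <= 0).

(* The operator with kernel k is f |-> (y |-> \int_X k x y * f x dx); here it
   is required to be the L2(X)-bounded operator
   f |-> \sum_k r ^ k <f, phi_k> phi_k, the series converging in L2(X). *)
Definition is_Abel_kernel X (phi : nat -> R -> R[i]) (r : R)
    (k : R -> R -> R[i]) : Prop :=
  measurable_fun (X `*` X) (fun z : R * R => complex.Re (k z.1 z.2)) /\
  measurable_fun (X `*` X) (fun z : R * R => complex.Im (k z.1 z.2)) /\
  forall f, in_L2 X f ->
    {ae mu, forall y, X y -> cintegrable X (fun x => k x y * f x)} /\
    (fun n => L2norm X (fun y =>
       \sum_(j < n) (r ^+ j)%:C * inner X f (phi j) * phi j y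
       - cintegral X (fun x => k x y * f x))) @ \oo --> 0%E.

End ComplexValued.

Section Lipschitz.
Variable R : realType.
Implicit Types (X : set R) (f g : R -> R[i]) (nu : R) (n : nat).

Notation mu := (@lebesgue_measure R).

Definition cbounded g : Prop := exists M : R, forall x, normc (g x) <= M.

Definition BMO g : Prop :=
  (forall a b : R, a < b -> cintegrable `]a, b[ g) /\
  exists M : R, forall a b : R, a < b ->
    let avg := cintegral `]a, b[ g / (b - a)%:C in
    (\int[mu]_(x in `]a, b[) normc (g x - avg)) / (b - a) <= M.

Definition Zygmund n g : Prop :=
  [/\ cbounded g, class_C setT n g
    & exists M : R, forall x h : R, h != 0 ->
      normc (cderiven n g (x + h) - 2%:R * cderiven n g x
             + cderiven n g (x - h)) / `|h| <= M].

Definition Holder nu g : Prop :=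
  let n := Num.truncn nu in
  [/\ cbounded g, class_C setT n g
    & exists M : R, forall x h : R, h != 0 ->
      normc (cderiven n g (x + h) - cderiven n g x)
        / `|h| `^ (nu - n%:R) <= M].

Definition Lip nu g : Prop :=
  if nu == 0 then BMO g
  else if nu \is a Num.nat then Zygmund (Num.truncn nu).-1 g
  else Holder nu g.

Definition LipX X nu f : Prop :=
  exists2 g, Lip nu g & forall x, X x -> f x = g x.

End Lipschitz.

Section Hardy.
Variable R : realType.
Implicit Types (X B : set R) (p t : R) (q : \bar R).
Implicit Types (psi Phi phi a g : R -> R[i]).

Notation mu := (@lebesgue_measure R).

Definition Schwartz psi : Prop :=
  (forall n, ndifferentiable setT n psi) /\
  forall i j : nat, exists M : R, forall x,
    `|x| ^+ i * normc (cderiven j psi x) <= M.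

(* A distribution is represented by a map of which only the values on
   Schwartz functions are used. *)
Definition distr := (R -> R[i]) -> R[i].
Implicit Type F : distr.

Definition tempered F : Prop :=
  (forall (z : R[i]) psi1 psi2, Schwartz psi1 -> Schwartz psi2 ->
     F (fun x => z * psi1 x + psi2 x) = z * F psi1 + F psi2) /\
  exists (N : nat) (C : R), forall psi (M : R), Schwartz psi ->
    (forall i j x, (i <= N)%N -> (j <= N)%N ->
       `|x| ^+ i * normc (cderiven j psi x) <= M) ->
    normc (F psi) <= C * M.

Definition dilate Phi t : R -> R[i] := fun x => (t^-1)%:C * Phi (x / t).

Definition convol F psi : R -> R[i] := fun x => F (fun y => psi (x - y)).

Definition maximal Phi F (x : R) : \bar R :=
  ereal_sup [set (normc (convol F (dilate Phi t) x))%:E | t in [set t | 0 < t]].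

(* A maximal function is lower semicontinuous, hence measurable. *)
Definition HpR Phi p F : Prop :=
  tempered F /\ (\int[mu]_x (maximal Phi F x `^ p) < +oo)%E.

Definition fun_support psi : set R := closure [set x | psi x != 0].

Definition supported_in X F : Prop :=
  forall psi, Schwartz psi -> compact (fun_support psi) ->
    fun_support psi `&` closure X = set0 -> F psi = 0.

(* An element of Hp(X) is represented by the distribution F on the line whose
   support lies in the closure of X, rather than by its restriction to the
   open set X: for bounded X and 1/2 < p < 1, a difference of Dirac masses at
   the two endpoints of X is a nonzero element, which the duality with
   Lipschitz functions has to see. *)
Definition HpX Phi p X F : Prop := HpR Phi p F /\ supported_in X F.

(* For q = +oo the exponent 1/q is 0. *)
Definition atom p q X a : Prop :=
  cmeasurable setT a /\
  exists B : set R,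
    [/\ is_interval B, bounded_set B, (0 < mu B)%E & B `<=` X] /\
    [/\ forall x, ~ B x -> a x = 0,
        (Lnorm mu q (fun x => (normc (a x))%:E)
           <= (fine (mu B) `^ (fine (q^-1) - p^-1))%:E)%E
      & forall i : nat, (i <= Num.truncn (p^-1 - 1))%N ->
          cintegral B (fun x => a x * (x ^+ i)%:C) = 0].

Definition atomic_decomposition p q X F
    (lam : nat -> R[i]) (a : nat -> R -> R[i]) : Prop :=
  [/\ forall j, atom p q X (a j),
      (\sum_(0 <= j <oo) (normc (lam j) `^ p)%:E < +oo)%E
    & forall psi, Schwartz psi ->
        cconv (fun n => \sum_(j < n) lam j *
                 cintegral setT (fun x => a j x * psi x)) (F psi)].

Definition Hp_norm p q X F : \bar R :=
  ereal_inf [set v | exists lam (a : nat -> R -> R[i]),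
     atomic_decomposition p q X F lam a /\
    v = ((\sum_(0 <= j <oo) (normc (lam j) `^ p)%:E) `^ (p^-1))%E].

(* F is the distribution given by the function g; the integrability forces g
   to be measurable and locally integrable. *)
Definition represents F g : Prop :=
  forall psi, Schwartz psi ->
    cintegrable setT (fun x => g x * psi x) /\
    F psi = cintegral setT (fun x => g x * psi x).

(* The (at most one) value of \int_X F phi^* when it makes sense. *)
Definition direct_values X F phi : set R[i] :=
  [set v | exists g, [/\ represents F g,
     cintegrable X (fun x => g x * (phi x)^*)
   & v = inner X g phi]].

Definition atomic_values p q X F phi : set R[i] :=
  [set v | exists lam (a : nat -> R -> R[i]),
     atomic_decomposition p q X F lam a /\
     cconv (fun n => \sum_(j < n) lam j * inner X (a j) phi) v].

(* [xget d A] is an element of A, and d if A is empty. *)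
Definition pairing p q X F phi : R[i] :=
  xget (xget 0 (atomic_values p q X F phi)) (direct_values X F phi).

End Hardy.

(* Main.v *)
Require Import Defs.
From HB Require Import structures.
From mathcomp Require Import all_boot all_order all_algebra.
From mathcomp Require Import finmap complex.
From mathcomp Require Import all_classical all_reals all_analysis.
From mathcomp Require Import measurable_realfun ring lra.
Import Order.TTheory GRing.Theory Num.Theory.
Import numFieldNormedType.Exports.
Local Open Scope classical_set_scope.
Local Open Scope ring_scope.
Local Open Scope complex_scope.

(* Test functions are finite differences of indicators. If f is the (P + 1)-st
   forward difference of the indicator of [h, 2h], then the integral of f u is
   the (P + 2)-nd difference of an antiderivative of u, so the mean value
   theorem gives <f, u> = h^(P + 2) u^(P + 1)(xi) with xi in [h, (P + 3) h].
   Applied to monomials this yields the vanishing moments of f, applied to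
   dilates of Phi it yields the decay of the maximal function, and applied to
   phi_k, for h ~ N^(-2 gamma) and N <= k < 2N, it yields
     |<f, phi_k>| >~ h^(P + 2) k^tau h^((1 + 2 tau - 2 gamma)/(4 gamma) - P - 1).
   Since f is a multiple of an atom, ||f|| <~ h^(1/p). Summing over k in
   [N, 2N), a constant C for the exponent E - eps would bound N^eps. *)

(** * Finite differences and step functions *)

(** The order P + 1 is forced twice. It kills the moments up to P, and it bounds the maximal
    function by a multiple of (1 + |x|)^-(P + 2), whose p-th power is integrable because 1/p - 1 < P
    + 1. The support starts at h rather than at 0, since the power of u in the hypothesis on phi_k
    may be singular at 0; on [h, (P + 3) h] it is comparable with the same power of h. One f serves
    the whole block N <= k < 2N, as the hypothesis with K = 2N covers all these k on a common
    interval. In the final count tau cancels: the gain s tau from (k + 1)^tau is offset by the term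
    2 tau / (4 gamma) in the exponent of h ~ N^(-2 gamma). What is left besides eps is exactly E.
    The obstacle is the value of <f, phi_k>. It is defined through some function representing the
    distribution of f, so f has to be the only such function up to null sets, and equality of
    distributions can be tested on Schwartz functions alone. Hence the explicit family of Schwartz
    functions that approximate indicators of half-lines times a Gaussian. *)

(* [is_derive] is a type class: as a universally quantified hypothesis it makes
   instance resolution loop, so it is wrapped here. *)
Definition has_deriv {R : realType} (f : R -> R) (x df : R) : Prop :=
  is_derive x 1 f df.

Lemma has_deriv1 {R : realType} (f : R -> R) x : derivable f x 1 ->
  has_deriv f x (derive1 f x).
Proof. by move=> fx; rewrite /has_deriv derive1E; exact: DeriveDef. Qed.

Lemma has_derivable {R : realType} (f : R -> R) x df : has_deriv f x df ->
  derivable f x 1.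
Proof. by rewrite /has_deriv => ?; exact: ex_derive. Qed.

Lemma has_deriv_val {R : realType} (f : R -> R) x df : has_deriv f x df ->
  derive1 f x = df.
Proof. by rewrite /has_deriv => ?; rewrite derive1E; exact: derive_val. Qed.

Fixpoint fdiff {R : realType} (h : R) (n : nat) (A : R -> R) (a : R) : R :=
  if n is k.+1 then fdiff h k A (a + h) - fdiff h k A a else A a.

Lemma fdiff_comm {R : realType} (h : R) n A a :
  fdiff h n (fun x => A (x + h) - A x) a = fdiff h n.+1 A a.
Proof. by elim: n a => // n IHn a /=; rewrite !IHn. Qed.

Lemma has_deriv_shift {R : realType} (f : R -> R) (h x df : R) :
  has_deriv f (x + h) df -> has_deriv (fun y => f (y + h)) x df.
Proof.
move=> fxh.
have dh : is_derive x 1 (fun y : R => y + h) (1 : R).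
  by apply: is_derive_eq; exact: addr0.
by have := @is_derive1_comp R f (fun y => y + h) x df 1 fxh dh; rewrite mulr1.
Qed.

Lemma has_deriv_MVT {R : realType} (f df : R -> R) (a b : R) : a <= b ->
  (forall x, a <= x <= b -> has_deriv f x (df x)) ->
  exists2 c, a <= c <= b & f b - f a = df c * (b - a).
Proof.
move=> ab fdf.
have fab x : x \in `]a, b[ -> has_deriv f x (df x).
  by rewrite in_itv /= => /andP[ax xb]; apply: fdf; rewrite !ltW.
have cf : {within `[a, b], continuous f}.
  apply: derivable_within_continuous => x; rewrite in_itv /= => /fdf.
  exact: has_derivable.
have [c cab E] := MVT_segment ab fab cf.
by exists c.
Qed.

(** Induction on [n]: the increments [A i (x + h) - A i x] again form a chain of derivatives, on an
    interval shorter by [h], and the ordinary mean value theorem turns the last increment into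
    [h * A n.+1 xi]. *)
Lemma fdiff_MVT {R : realType} (h a : R) n (A : nat -> R -> R) : 0 <= h ->
  (forall i x, (i < n)%N -> a <= x <= a + n%:R * h ->
     has_deriv (A i) x (A i.+1 x)) ->
  exists2 xi, a <= xi <= a + n%:R * h & fdiff h n (A 0%N) a = h ^+ n * A n xi.
Proof.
move=> h0; elim: n A => [|n IHn] A dA.
  by exists a; rewrite ?expr0 ?mul1r// mul0r addr0 lexx.
have [] := IHn (fun i x => A i (x + h) - A i x).
  move=> i x ni /andP[ax xb]; apply: is_deriveB.
    apply: has_deriv_shift; apply: dA; first exact: ltnW.
    by rewrite -natr1 mulrDl mul1r addrA lerD2r xb andbT ler_wpDr.
  apply: dA; first exact: ltnW.
  by rewrite -natr1 mulrDl mul1r addrA ax /= ler_wpDr.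
move=> x /andP[ax xb]; rewrite fdiff_comm => ->.
have xh : x <= x + h by rewrite lerDl.
have bh : x + h <= a + n.+1%:R * h.
  by rewrite -natr1 mulrDl mul1r addrA lerD2r.
have [xi /andP[xxi xib] ->] : exists2 xi, x <= xi <= x + h &
    A n (x + h) - A n x = A n.+1 xi * (x + h - x).
  apply: has_deriv_MVT => // y /andP[xy yb]; apply: dA => //.
  by rewrite (le_trans ax xy) (le_trans yb bh).
exists xi; first by rewrite (le_trans ax xxi) (le_trans xib bh).
by rewrite exprS; ring.
Qed.

(** The first difference is at most [C] and each further one doubles the bound. Only the oscillation
    of [A] enters, which suits antiderivatives, known up to a constant. *)
Lemma fdiff_le {R : realType} (h C a b : R) n (A : R -> R) : 0 <= h ->
  (forall x y, a <= x <= b -> a <= y <= b -> `|A x - A y| <= C) ->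
  a + n.+1%:R * h <= b -> `|fdiff h n.+1 A a| <= C *+ 2 ^ n.
Proof.
move=> h0 hA; elim: n a hA => [|n IHn] a hA hb.
  have ah : a <= a + h by rewrite lerDl.
  move: hb; rewrite mul1r => hb.
  by apply: hA; rewrite ?lexx ?ah ?hb//= (le_trans ah hb).
rewrite expnS mul2n -addnn mulrnDr (le_trans (ler_normB _ _))// lerD//.
  apply: IHn => [x y /andP[ax xb] /andP[ay yb]|].
    by apply: hA; rewrite ?xb ?yb andbT; [apply: le_trans ax|apply: le_trans ay]; rewrite lerDl.
  by move: hb; rewrite -[n.+2%:R]natr1 mulrDl mul1r -addrA (addrC h).
by apply: IHn => //; rewrite (le_trans _ hb)// lerD2l ler_wpM2r// ler_nat.
Qed.

(* The k-th forward difference of the indicator of [a, a + h]. Consecutive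
   closed intervals share an endpoint, which integrals do not see. *)
Fixpoint step {R : realType} (h : R) (k : nat) (a x : R) : R :=
  if k is j.+1 then step h j (a + h) x - step h j a x
  else \1_(`[a, a + h]) x.

Lemma measurable_step {R : realType} (h : R) k a (D : set R) :
  measurable_fun D (step h k a).
Proof.
elim: k a => [|k IHk] a /=; first exact: measurable_indic.
exact: measurable_funB.
Qed.

Lemma step_le {R : realType} (h : R) k a x : `|step h k a x| <= 2 ^+ k.
Proof.
elim: k a => [|k IHk] a /=.
  by rewrite expr0 indicE; case: (_ \in _); rewrite ?normr1// normr0.
by rewrite exprS mulr2n mulrDl mul1r (le_trans (ler_normB _ _))// lerD.
Qed.

Lemma step_supp {R : realType} (h : R) k a x : 0 <= h ->
  ~~ (a <= x <= a + k.+1%:R * h) -> step h k a x = 0.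
Proof.
move=> h0; elim: k a => [|k IHk] a /=.
  by rewrite mul1r indicE mem_setE in_itv /= => /negbTE ->.
move=> H; rewrite !IHk ?subrr//; apply: contra H => /andP[ax xb].
  by rewrite ax (le_trans xb)// lerD2l ler_wpM2r// ler_nat.
rewrite (le_trans _ ax) ?lerDl//= (le_trans xb)//.
by rewrite -[k.+2%:R]natr1 mulrDl mul1r -addrA (addrC h).
Qed.

Lemma integrable_patch {R : realType} (D B : set R) (u : R -> R) :
  measurable D -> measurable B -> B `<=` D ->
  (@lebesgue_measure R).-integrable B (EFin \o u) ->
  (@lebesgue_measure R).-integrable D (EFin \o (u \_ B)).
Proof.
move=> mD mB BD iu; rewrite -restrict_EFin.
apply/(@integrable_mkcond _ _ _ (@lebesgue_measure R) D _ mD).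
rewrite -patch_setI setIC (iffRL (setIidPl _ _) BD)//.
exact/(@integrable_mkcond _ _ _ (@lebesgue_measure R) B _ mB).
Qed.

(** The antiderivative [A] is a parameter so that both translates in the induction step share it;
    the recursions of [step] and [fdiff] then match, and the base case is the fundamental theorem of
    calculus. *)
Lemma integral_step {R : realType} (h : R) k a (D : set R) (A u : R -> R) :
  let I := `[a, a + k.+1%:R * h] in
  0 < h -> measurable D -> [set` I] `<=` D ->
  {in I, forall x, has_deriv A x (u x)} -> {within [set` I], continuous u} ->
  (@lebesgue_measure R).-integrable D (EFin \o (fun x => step h k a x * u x)) /\
  \int[@lebesgue_measure R]_(x in D) (step h k a x * u x) = fdiff h k.+1 A a.
Proof.
move=> I h0 mD; rewrite {}/I; elim: k a => [|k IHk] a ID dA cu.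
  rewrite mul1r in ID dA cu; rewrite /step /fdiff.
  have aah : a < a + h by rewrite ltrDl.
  have E : (fun x => \1_`[a, a + h] x * u x) = u \_ `[a, a + h].
    by apply/funext => x; rewrite patch_indic mulrC.
  have iu : (@lebesgue_measure R).-integrable `[a, a + h] (EFin \o u).
    by apply: continuous_compact_integrable => //; exact: segment_compact.
  have IS : D `&` [set` `[a, a + h]] = [set` `[a, a + h]] by rewrite setIC; apply/setIidPl.
  split; first by rewrite E; exact: integrable_patch.
  rewrite E -Rintegral_mkcondr IS /Rintegral (continuous_FTC2 (F := A))//.
    split.
    - move=> x; rewrite in_itv /= => /andP[/ltW ax /ltW xb].
      by apply: has_derivable (dA x _); rewrite in_itv /= ax.
    - apply: cvg_at_right_filter; apply: differentiable_continuous.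
      apply/derivable1_diffP; apply: has_derivable (dA a _).
      by rewrite in_itv /= lexx ltW.
    - apply: cvg_at_left_filter; apply: differentiable_continuous.
      apply/derivable1_diffP; apply: has_derivable (dA (a + h) _).
      by rewrite in_itv /= lexx ltW.
  move=> x; rewrite in_itv /= => /andP[/ltW ax /ltW xb].
  by apply: has_deriv_val; apply: dA; rewrite in_itv /= ax.
have S1 : `[a, a + k.+1%:R * h] `<=` `[a, a + k.+2%:R * h].
  move=> x; rewrite /= !in_itv /= => /andP[-> xb] /=.
  by rewrite (le_trans xb)// lerD2l ler_pM2r// ler_nat.
have S2 : `[a + h, a + h + k.+1%:R * h] `<=` `[a, a + k.+2%:R * h].
  move=> x; rewrite /= !in_itv /= => /andP[ax xb].
  rewrite (le_trans _ ax) ?lerDl ?(ltW h0)//= (le_trans xb)//.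
  by rewrite -[k.+2%:R]natr1 mulrDl mul1r -addrA (addrC h).
have [i1 E1] := IHk a (subset_trans S1 ID) (sub_in1 S1 dA) (continuous_subspaceW S1 cu).
have [i2 E2] := IHk _ (subset_trans S2 ID) (sub_in1 S2 dA) (continuous_subspaceW S2 cu).
have E : (fun x => step h k.+1 a x * u x) =
    (fun x => step h k (a + h) x * u x - step h k a x * u x).
  by apply/funext => x /=; rewrite mulrBl.
rewrite E; split; first exact: (@integrableB _ _ _ (@lebesgue_measure R) D mD _ _ i2 i1).
by rewrite RintegralB// E1 E2.
Qed.

Lemma has_antideriv {R : realType} (u : R -> R) (lo a b hi : R) :
  lo < a -> a <= b -> b < hi -> {in `]lo, hi[, continuous u} ->
  exists A, forall x, a <= x <= b -> has_deriv A x (u x).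
Proof.
(* Continuity is known on the open interval only, where [u] may blow up at the ends. The midpoints
   bound a compact interval with [[a, b]] in its interior. *)
move=> loa ab bhi cu; pose lo' := (lo + a) / 2; pose hi' := (b + hi) / 2.
have lohi : `[lo', hi'] `<=` `]lo, hi[.
  by move=> x; rewrite /= !in_itv /= /lo' /hi' => /andP[? ?]; apply/andP; split; lra.
have cw : {within `[lo', hi'], continuous u}.
  by apply: continuous_in_subspaceT => x; rewrite inE => /lohi; exact: cu.
exists (fun x => \int[@lebesgue_measure R]_(t in `[lo', x]) u t) => x /andP[ax xb].
have [||||dA <-] := @continuous_FTC1 R u (BLeft lo') x hi'.
- by rewrite /hi'; lra.
- by apply: continuous_compact_integrable => //; exact: segment_compact.
- by rewrite lte_fin /lo'; lra.
- by apply: cu; rewrite in_itv /=; apply/andP; split; lra.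
- exact: has_deriv1.
Qed.

Lemma integral_step_MVT {R : realType} (h : R) k a (D : set R) (lo hi : R)
    (u : nat -> R -> R) :
  0 < h -> measurable D -> `[a, a + k.+1%:R * h] `<=` D ->
  lo < a -> a + k.+1%:R * h < hi -> {in `]lo, hi[, continuous (u 0%N)} ->
  (forall i x, (i < k)%N -> lo < x < hi -> has_deriv (u i) x (u i.+1 x)) ->
  (@lebesgue_measure R).-integrable D (EFin \o (fun x => step h k a x * u 0%N x)) /\
  exists2 xi, a <= xi <= a + k.+1%:R * h &
  \int[@lebesgue_measure R]_(x in D) (step h k a x * u 0%N x) =
    h ^+ k.+1 * u k xi.
Proof.
move=> h0 mD ID loa bhi cu du; set b := a + _ in ID bhi *.
have ab : a < b by rewrite ltrDl mulr_gt0.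
have [A dA] := has_antideriv _ _ _ _ _ loa (ltW ab) bhi cu.
have Iab : `[a, b] `<=` `]lo, hi[.
  move=> x; rewrite /= !in_itv /= => /andP[ax xb].
  by rewrite (lt_le_trans loa ax) (le_lt_trans xb bhi).
have cw : {within `[a, b], continuous (u 0%N)}.
  by apply: continuous_in_subspaceT => x; rewrite inE => /Iab; exact: cu.
have [iu ->] := @integral_step R h k a D A (u 0%N) h0 mD ID dA cw.
split => //.
(* Prepending the antiderivative shifts the chain by one, so the difference of order [k.+1] meets
   [u k]. *)
apply: (@fdiff_MVT R h a k.+1 (fun i => if i is j.+1 then u j else A) (ltW h0)).
move=> [|i] x; first by move=> _; exact: dA.
rewrite ltnS => ik /andP[ax xb]; apply: du => //.
by rewrite (lt_le_trans loa ax) (le_lt_trans xb bhi).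
Qed.

(** Since [|u| <= w], both [W + A] and [W - A] are nondecreasing for an antiderivative [A] of [u],
    so [A] oscillates no more than [W]. The bound is free of [h] and of the size of [u], which makes
    it uniform over dilates. *)
Lemma integral_step_le {R : realType} (h : R) k a (D : set R) (C : R)
    (u w W : R -> R) :
  0 < h -> measurable D -> `[a, a + k.+1%:R * h] `<=` D -> continuous u ->
  (forall x, has_deriv W x (w x)) -> (forall x, `|u x| <= w x) ->
  (forall x y, W x - W y <= C) ->
  `|\int[@lebesgue_measure R]_(x in D) (step h k a x * u x)| <= C *+ 2 ^ k.
Proof.
move=> h0 mD ID cu dW uw WC; set b := a + _ in ID *.
have ab : a < b by rewrite ltrDl mulr_gt0.
have [A dA] : exists A, forall x, a <= x <= b -> has_deriv A x (u x).
  apply: (@has_antideriv R u (a - 1) a b (b + 1)); rewrite ?ltrDl ?ltrBlDr ?ltrDl//.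
  exact: ltW.
have [_ ->] := @integral_step R h k a D A u h0 mD ID dA (continuous_subspaceT cu).
apply: (@fdiff_le R h C a b k A (ltW h0)); last exact: lexx.
move=> x y.
have mono (x' y' : R) : a <= x' <= b -> a <= y' <= b -> x' <= y' ->
    `|A y' - A x'| <= C.
  move=> /andP[ax xb] /andP[ay yb] xy.
  have dA' z : x' <= z <= y' -> has_deriv A z (u z).
    by move=> /andP[xz zy]; apply: dA; rewrite (le_trans ax xz) (le_trans zy yb).
  rewrite ler_norml; apply/andP; split.
    have [|c _] := @has_deriv_MVT R (W \+ A) (w \+ u) x' y' xy.
      by move=> z /dA' dz; apply: is_deriveD; [exact: dW|exact: dz].
    have : 0 <= (w c + u c) * (y' - x').
      rewrite mulr_ge0 ?subr_ge0// addrC -lerBlDr sub0r lerNl.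
      by have := uw c; rewrite ler_norml => /andP[? _]; rewrite lerNl.
    by move=> /= + E; rewrite -E; have := WC y' x'; lra.
  have [|c _] := @has_deriv_MVT R (W \- A) (w \- u) x' y' xy.
    by move=> z /dA' dz; apply: is_deriveB; [exact: dW|exact: dz].
  have : 0 <= (w c - u c) * (y' - x').
    by rewrite mulr_ge0 ?subr_ge0//; have := uw c; rewrite ler_norml => /andP[].
  by move=> /= + E; rewrite -E; have := WC y' x'; lra.
have [xy|/ltW yx] := leP x y => xI yI; last exact: mono.
by rewrite distrC; exact: mono.
Qed.

(** * Functions orthogonal to all Schwartz functions *)

Lemma normc_real {R : rcfType} (x : R) : normc x%:C = `|x|.
Proof. by rewrite /ComplexField.Normc.normc /= expr0n /= addr0 sqrtr_sqr. Qed.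

Lemma abs_Re_le {R : rcfType} (z : R[i]) : `|complex.Re z| <= normc z.
Proof.
by case: z => a b; rewrite -sqrtr_sqr /= ler_wsqrtr// lerDl sqr_ge0.
Qed.

Lemma abs_Im_le {R : rcfType} (z : R[i]) : `|complex.Im z| <= normc z.
Proof.
by case: z => a b; rewrite -sqrtr_sqr /= ler_wsqrtr// lerDr sqr_ge0.
Qed.

Lemma normc_le {R : rcfType} (z : R[i]) :
  normc z <= `|complex.Re z| + `|complex.Im z|.
Proof.
case: z => a b /=.
rewrite -[leRHS]ger0_norm ?addr_ge0// -[leRHS]sqrtr_sqr ler_wsqrtr//.
by rewrite sqrrD !real_normK ?num_real// lerD2r lerDl mulrn_wge0// mulr_ge0.
Qed.

(** Spares computing higher derivatives: a class closed under one differentiation contains them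
    all. *)
Lemma Schwartz_of_class {R : realType} (S : (R -> R) -> Prop) (f : R -> R) :
  (forall g, S g -> exists2 g', S g' & forall x, has_deriv g x (g' x)) ->
  (forall g, S g -> forall i : nat, exists M, forall x, `|x| ^+ i * `|g x| <= M) ->
  S f -> Schwartz (fun x => (f x)%:C).
Proof.
move=> dS bS Sf.
have Sn n : S (derive1n n f).
  elim: n => [//|n /dS[g' Sg' dg']].
  suff -> : derive1n n.+1 f = g' by [].
  by apply/funext => x; rewrite -(has_deriv_val _ _ _ (dg' x)).
have rf : rpart (fun x => (f x)%:C) = f by [].
have if0 : ipart (fun x => (f x)%:C) = cst 0 by [].
have d0 n : derive1n n (cst 0 : R -> R) = cst 0.
  elim: n => // n IHn; rewrite /derive1n iterS [iter _ _ _]IHn.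
  by apply/funext => x; rewrite derive1_cst.
split=> [n i ni x _|i j].
  rewrite rf if0 d0; split => //.
  by have [g' _ dg] := dS _ (Sn i); exact: has_derivable (dg x).
have [M HM] := bS _ (Sn j) i.
by exists M => x; rewrite /cderiven rf if0 d0 normc_real.
Qed.

(* Contains smooth approximations of the indicators of half-lines while being
   visibly stable under differentiation, because s' = l s (1 - s). *)
Inductive gauss_span {R : realType} (s : R -> R) : (R -> R) -> Prop :=
| gauss_term i j : gauss_span s (fun x => x ^+ i * s x ^+ j * expR (- x ^+ 2))
| gauss_add f g : gauss_span s f -> gauss_span s g -> gauss_span s (f \+ g)
| gauss_scale (c : R) f : gauss_span s f -> gauss_span s (fun x => c * f x).

Lemma gauss_span_deriv {R : realType} (l : R) (s f : R -> R) :
  (forall x, has_deriv s x (l * s x * (1 - s x))) -> gauss_span s f ->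
  exists2 f', gauss_span s f' & forall x, has_deriv f x (f' x).
Proof.
move=> ds; elim=> [i j|g1 g2 _ [g1' S1 d1] _ [g2' S2 d2]|c g _ [g' Sg dg]].
(* One term comes from the monomial, two from [s ^+ j] through [s' = l s - l s^2], one from the
   Gaussian. For [i = 0] the truncated exponent [i.-1] is multiplied by 0. *)
- exists ((fun x => i%:R * (x ^+ i.-1 * s x ^+ j * expR (- x ^+ 2))) \+
    ((fun x => (j%:R * l) * (x ^+ i * s x ^+ j * expR (- x ^+ 2))) \+
    ((fun x => (- (j%:R * l)) * (x ^+ i * s x ^+ j.+1 * expR (- x ^+ 2))) \+
     (fun x => - 2 * (x ^+ i.+1 * s x ^+ j * expR (- x ^+ 2)))))).
    by do !apply: gauss_add; apply: gauss_scale; exact: gauss_term.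
  move=> x.
  have di : is_derive x 1 ((@id R) ^+ i) ((i%:R * x ^+ i.-1) *: 1) by exact: is_deriveX.
  have dj : is_derive x 1 (s ^+ j) ((j%:R * s x ^+ j.-1) *: (l * s x * (1 - s x))).
    by apply: is_deriveX; exact: ds.
  have de : is_derive x 1 (expR \o (fun x : R => - x ^+ 2))
      (expR (- x ^+ 2) * (- ((2%:R * x ^+ 1) *: 1))).
    apply: is_derive1_comp; apply: is_deriveN.
    by have := @is_deriveX R R (@id R) 2 x 1 1 (is_derive_id _ _).
  have := is_deriveM (is_deriveM di dj) de.
  rewrite /has_deriv; set F := (F in is_derive _ _ F _ -> _).
  rewrite (_ : F = fun x => x ^+ i * s x ^+ j * expR (- x ^+ 2)).
    move=> H; apply: is_derive_eq; rewrite /GRing.scale /= !fctE.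
    case: j {dj F H} => [|j] /=; rewrite ?expr0 ?exprS; ring.
  by apply/funext => y; rewrite /F /= !fctE.
- exists (g1' \+ g2'); first exact: gauss_add.
  by move=> x; apply: is_deriveD; [exact: d1|exact: d2].
- exists (fun x => c * g' x); first exact: gauss_scale.
  by move=> x; apply: is_deriveZ; exact: dg.
Qed.

(** Combines [|x|^n <= 1 + (x^2)^n] with [(x^2)^n / n! <= expR (x^2)], a term of the exponential
    series. *)
Lemma expr_gauss_le {R : realType} (x : R) n :
  `|x| ^+ n * expR (- x ^+ 2) <= 1 + n`!%:R.
Proof.
have xn : `|x| ^+ n <= 1 + (x ^+ 2) ^+ n.
  have [x1|/ltW x1] := leP `|x| 1.
    by rewrite (le_trans (exprn_ile1 _ (normr_ge0 x) x1))// lerDl exprn_ge0// sqr_ge0.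
  rewrite -[x ^+ 2]real_normK ?num_real// -exprM mulnC exprM.
  rewrite ler_wpDl// expr2 ler_peMl ?exprn_ge0//.
  exact: exprn_ege1.
have x2e : (x ^+ 2) ^+ n <= n`!%:R * expR (x ^+ 2).
  case: n {xn} => [|n]; first by rewrite expr0 fact0 mul1r -expR0 ler_expR sqr_ge0.
  rewrite mulrC -ler_pdivrMr ?ltr0n ?fact_gt0//.
  by rewrite (le_trans _ (expR_ge1Dxn n (sqr_ge0 x)))// lerDr.
rewrite expRN ler_pdivrMr ?expR_gt0// mulrDl mul1r (le_trans xn)//.
by rewrite lerD// -expR0 ler_expR sqr_ge0.
Qed.

Lemma gauss_span_bounded {R : realType} (s f : R -> R) :
  (forall x, 0 <= s x <= 1) -> gauss_span s f ->
  forall i : nat, exists M, forall x, `|x| ^+ i * `|f x| <= M.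
Proof.
move=> s01 Sf i; elim: Sf => [k j|g1 g2 _ [M1 h1] _ [M2 h2]|c g _ [M h]].
- exists (1 + (i + k)`!%:R) => x.
  have /andP[s0 s1] := s01 x.
  apply: le_trans (expr_gauss_le x (i + k)).
  rewrite !normrM !normrX mulrA mulrA -exprD (ger0_norm (expR_ge0 _)).
  rewrite ler_wpM2r ?expR_ge0// ler_piMr ?exprn_ge0// exprn_ile1//.
  by rewrite ger0_norm.
- exists (M1 + M2) => x; apply: le_trans (lerD (h1 x) (h2 x)).
  by rewrite -mulrDr ler_wpM2l ?exprn_ge0// ler_normD.
- exists (`|c| * M) => x; rewrite normrM mulrCA.
  by rewrite ler_wpM2l.
Qed.

Definition logistic {R : realType} (l y x : R) : R := (1 + expR (l * (x - y)))^-1.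

Lemma logistic_itv {R : realType} (l y x : R) : 0 <= logistic l y x <= 1.
Proof.
have e0 := expR_gt0 (l * (x - y)).
have e1 : 0 < 1 + expR (l * (x - y)) by rewrite addr_gt0.
by rewrite /logistic invr_ge0 (ltW e1) /= invf_le1// lerDl ltW.
Qed.

Lemma logistic_deriv {R : realType} (l y x : R) :
  has_deriv (logistic l y) x (- l * logistic l y x * (1 - logistic l y x)).
Proof.
have e0 := expR_gt0 (l * (x - y)).
have n0 : 1 + expR (l * (x - y)) != 0 by rewrite gt_eqF// addr_gt0.
have dl : is_derive x 1 (fun z : R => l * (z - y)) l.
  have : is_derive x 1 (fun z : R => z - y) (1 : R).
    by apply: is_derive_eq; exact: subr0.
  by move=> H; have := @is_deriveZ R R R _ l x 1 1 H; rewrite /GRing.scale /= mulr1.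
have de : is_derive x 1 (fun z : R => 1 + expR (l * (z - y))) (expR (l * (x - y)) * l).
  have H := @is_derive1_comp _ expR (fun z : R => l * (z - y)) _ _ _
    (is_derive_expR _) dl.
  have := is_deriveD (is_derive_cst (1 : R) x 1) H.
  by rewrite add0r.
have := is_deriveV (f := fun z : R => 1 + expR (l * (z - y))) n0 de.
rewrite /has_deriv => H; apply: is_derive_eq.
by rewrite /GRing.scale /= /logistic; field.
Qed.

Lemma Schwartz_logistic {R : realType} (l y : R) j :
  Schwartz (fun x => (logistic l y x ^+ j * expR (- x ^+ 2))%:C).
Proof.
apply: (@Schwartz_of_class R (gauss_span (logistic l y))).
- by move=> g; apply: gauss_span_deriv; exact: logistic_deriv.
- by move=> g; apply: gauss_span_bounded; exact: logistic_itv.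
rewrite [X in gauss_span _ X](_ : _ =
  fun x => x ^+ 0 * logistic l y x ^+ j * expR (- x ^+ 2)); first exact: gauss_term.
by apply/funext => x; rewrite expr0 mul1r.
Qed.

(** [expR (n (x - y))] is a geometric sequence whose ratio is below 1 for x < y and above 1 for x >
    y. At x = y the value is 1/2 for all n. *)
Lemma cvg_logistic {R : realType} (y x : R) : x != y ->
  logistic n%:R y x @[n --> \oo] --> (\1_(`]-oo, y]) x : R).
Proof.
move=> xy; rewrite indicE mem_setE in_itv /=.
rewrite /logistic; under eq_fun do rewrite expRM_natl.
have z0 : 0 < expR (x - y) by exact: expR_gt0.
have [xley|yx] := leP x y.
  have {}xy : x < y by rewrite lt_neqAle xy.
  have z1 : `|expR (x - y)| < 1 by rewrite ger0_norm ?ltW// -expR0 ltr_expR subr_lt0.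
  have /= -> : 1%:R = (1 + 0)^-1 :> R by rewrite addr0 invr1.
  apply: cvgV; first by rewrite addr0 oner_neq0.
  by apply: cvgD; [exact: cvg_cst|exact: cvg_expr].
have z1 : `|(expR (x - y))^-1| < 1.
  by rewrite ger0_norm ?invr_ge0 ?(ltW z0)// -expRN -expR0 ltr_expR oppr_lt0 subr_gt0.
have -> : (nat_of_bool false)%:R = 0 :> R by [].
apply: (@squeeze_cvgr _ _ _ _ (cst 0) (fun n => (expR (x - y))^-1 ^+ n)).
- apply: nearW => n /=; rewrite invr_ge0 addr_ge0 ?exprn_ge0 ?(ltW z0)//= exprVn.
  by rewrite lef_pV2 ?posrE ?exprn_gt0 ?addr_gt0 ?exprn_gt0// lerDr.
- exact: cvg_cst.
- exact: cvg_expr.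
Qed.

(** The Gaussian factor makes [G] integrable although [u] need not be. Testing with steep logistic
    functions times the Gaussian shows that all integrals of [G] over half-lines vanish, and
    differentiating them gives [G = 0] almost everywhere. *)
Lemma Schwartz_orthogonal_ae0 {R : realType} (u : R -> R) :
  (forall w : R -> R, Schwartz (fun x => (w x)%:C) ->
     (@lebesgue_measure R).-integrable setT (EFin \o (fun x => u x * w x)) /\
     \int[@lebesgue_measure R]_x (u x * w x) = 0) ->
  {ae (@lebesgue_measure R), forall x, u x = 0}.
Proof.
move=> uw; set mu := @lebesgue_measure R.
pose G x := u x * expR (- x ^+ 2).
have GE : G = (fun x => u x * (logistic 0 0 x ^+ 0 * expR (- x ^+ 2))).
  by apply/funext => x; rewrite expr0 mul1r.
have iG : mu.-integrable setT (EFin \o G).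
  by rewrite GE; exact: (uw _ (Schwartz_logistic 0 0 0)).1.
have mG : measurable_fun setT G by apply/measurable_EFinP; exact: measurable_int iG.
have G0 y : \int[mu]_(x in `]-oo, y]) G x = 0.
  pose f n x := (u x * (logistic n%:R y x ^+ 1 * expR (- x ^+ 2))).
  have f0 n := uw _ (Schwartz_logistic n%:R y 1).
  have [|||||_ _] := @dominated_convergence _ _ _ mu setT measurableT
    (fun n => EFin \o f n) (EFin \o (G \_ `]-oo, y])) (fun x => `|G x|%:E).
  - by move=> n; exact: measurable_int (f0 n).1.
  - apply/measurable_EFinP.
    by apply/(measurable_restrict _ _ _).1 => //; rewrite setTI; exact: measurable_funTS.
  (* The jump point is the only place where the logistic functions may miss the indicator. *)
  - exists [set y]; split => //; first exact: lebesgue_measure_set1.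
    move=> x /=; apply: contra_notP => xy _.
    rewrite patch_indic /f /=; apply: cvg_EFin; first exact: nearW.
    have -> : G x * \1_`]-oo, y] x = u x * (\1_`]-oo, y] x * expR (- x ^+ 2)).
      by rewrite /G mulrAC -mulrA.
    apply: cvgM; first exact: cvg_cst.
    apply: cvgM; last exact: cvg_cst.
    by under eq_fun do rewrite expr1; apply: cvg_logistic; exact/eqP.
  - exact: integrable_abse iG.
  - apply/aeW => x n _ /=; rewrite lee_fin /G /f !normrM ler_wpM2l// ler_piMl//.
    by have /andP[l0 l1] := logistic_itv n%:R y x; rewrite expr1 ger0_norm.
  rewrite (_ : (fun n => _) = cst 0%E); last first.
    apply/funext => n /=.
    rewrite -(fineK (integrable_fin_num measurableT (f0 n).1)).
    by have := (f0 n).2; rewrite /Rintegral => ->.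
  move/(cvg_unique (@ereal_hausdorff R)) => /(_ _ (cvg_cst _)).
  by rewrite Rintegral_mkcond => I0; exact: (congr1 fine I0).
(* At a Lebesgue point, [G x] is the derivative of the half-line integral, which is constantly 0. *)
have := lebesgue_differentiation (open_integrable_locally openT iG).
apply: filterS; first exact: (ae_filter_ringOfSetsType (@lebesgue_measure R)).
move=> x xG.
have iGx : mu.-integrable `]-oo, x + 1] (EFin \o G) by exact: integrableS iG.
have [] := @FTC1_lebesgue_pt R G (BInfty _ true) x (x + 1) _ iGx _ xG.
- by rewrite ltrDl.
- by rewrite ltNyr.
move=> _; rewrite (_ : (fun y => _) = cst 0); last by apply/funext => y; exact: G0.
rewrite derive1_cst /G => /esym/eqP; rewrite mulf_eq0 => /orP[/eqP//|].
by rewrite gt_eqF// expR_gt0.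
Qed.

Lemma rpart_realM {R : realType} (w : R -> R) (g : R -> R[i]) :
  rpart (fun x => (w x)%:C * g x) = (fun x => w x * rpart g x).
Proof. by apply/funext => x; rewrite /rpart; case: (g x) => a b /=; rewrite mul0r subr0. Qed.

Lemma ipart_realM {R : realType} (w : R -> R) (g : R -> R[i]) :
  ipart (fun x => (w x)%:C * g x) = (fun x => w x * ipart g x).
Proof. by apply/funext => x; rewrite /ipart; case: (g x) => a b /=; rewrite mul0r addr0. Qed.

(** Real-valued test functions separate real and imaginary parts, so the real statement applies to
    each difference. *)
Lemma represents_ae_unique {R : realType} (F : distr R) (g1 g2 : R -> R[i]) :
  represents F g1 -> represents F g2 ->
  {ae (@lebesgue_measure R), forall x, g1 x = g2 x}.
Proof.
move=> F1 F2.
have wC w g : (fun x => g x * (w x)%:C) = (fun x => (w x : R)%:C * (g x : R[i])).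
  by apply/funext => x; rewrite mulrC.
have re0 : {ae (@lebesgue_measure R), forall x, rpart g1 x - rpart g2 x = 0}.
  apply: Schwartz_orthogonal_ae0 => w Sw.
  have [] := F1 _ Sw; have [] := F2 _ Sw.
  rewrite !wC /cintegrable /cintegral !rpart_realM !ipart_realM.
  move=> [i2 _] E2 [i1 _]; rewrite E2 => -[E _].
  rewrite (_ : (fun x => (rpart g1 x - rpart g2 x) * w x) =
    (fun x => w x * rpart g1 x - w x * rpart g2 x)); last first.
    by apply/funext => x; rewrite -mulrBr mulrC.
  split; first exact: (@integrableB _ _ _ (@lebesgue_measure R) setT measurableT _ _ i1 i2).
  by rewrite RintegralB// E subrr.
have im0 : {ae (@lebesgue_measure R), forall x, ipart g1 x - ipart g2 x = 0}.
  apply: Schwartz_orthogonal_ae0 => w Sw.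
  have [] := F1 _ Sw; have [] := F2 _ Sw.
  rewrite !wC /cintegrable /cintegral !rpart_realM !ipart_realM.
  move=> [_ i2] E2 [_ i1]; rewrite E2 => -[_ E].
  rewrite (_ : (fun x => (ipart g1 x - ipart g2 x) * w x) =
    (fun x => w x * ipart g1 x - w x * ipart g2 x)); last first.
    by apply/funext => x; rewrite -mulrBr mulrC.
  split; first exact: (@integrableB _ _ _ (@lebesgue_measure R) setT measurableT _ _ i1 i2).
  by rewrite RintegralB// E subrr.
have := ae_filter_ringOfSetsType (@lebesgue_measure R) => FF.
apply: filterS2 re0 im0 => x /eqP; rewrite subr_eq0 => /eqP rx /eqP.
rewrite subr_eq0 => /eqP ix; move: rx ix; rewrite /rpart /ipart.
by case: (g1 x) (g2 x) => a b [a' b'] /= -> ->.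
Qed.

(* [pairing] picks an unspecified representing function, so that uniqueness of
   the latter is what gives the pairing its value. *)
Lemma pairing_represents {R : realType} (p : R) (q : \bar R) (X : set R)
    (F : distr R) (phi g : R -> R[i]) : measurable X -> represents F g ->
  cintegrable X (fun x => g x * (phi x)^*) ->
  pairing p q X F phi = inner X g phi.
Proof.
move=> mX Fg ig; apply: xget_unique; first by exists g.
move=> _ [g' [Fg' [ir ii] ->]]; case: ig => jr ji.
have gg' := represents_ae_unique _ _ _ Fg' Fg.
have := ae_filter_ringOfSetsType (@lebesgue_measure R) => FF.
rewrite /inner /cintegral; congr (_ +i* _); congr fine.
  apply: (@ae_eq_integral _ _ _ (@lebesgue_measure R) X) => //.
  - exact: measurable_int ir.
  - exact: measurable_int jr.
  by apply: filterS gg' => x E Xx; rewrite /= /rpart E.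
apply: (@ae_eq_integral _ _ _ (@lebesgue_measure R) X) => //.
- exact: measurable_int ii.
- exact: measurable_int ji.
by apply: filterS gg' => x E Xx; rewrite /= /ipart E.
Qed.

(** * Membership in the Hardy space *)

(* Unlike [ge0_le_integral], needs no measurability: it is applied to a maximal
   function. *)
Lemma ge0_le_integralT {R : realType} (f g : R -> \bar R) :
  (forall x, 0 <= f x)%E -> (forall x, f x <= g x)%E ->
  (\int[@lebesgue_measure R]_x f x <= \int[@lebesgue_measure R]_x g x)%E.
Proof.
move=> f0 fg; have g0 x : (0 <= g x)%E := le_trans (f0 x) (fg x).
rewrite !ge0_integralTE//; apply: ereal_sup_le => _ /= [h hf <-].
by exists h => // x; apply: le_trans (fg x).
Qed.

Lemma integral_powR_fin {R : realType} (al : R) : 1 < al ->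
  (\int[@lebesgue_measure R]_x ((1 + `|x|) `^ (- al))%:E < +oo)%E.
Proof.
move=> al1; have bt0 : 0 < al - 1 by rewrite subr_gt0.
have p1 (x : R) : 0 < 1 + `|x| by rewrite ltr_pwDl.
rewrite ge0_symfun_integralT; last 3 first.
- by move=> x; exact: powR_ge0.
- move=> x; apply: (@continuous_comp _ _ _ (fun x : R => 1 + `|x|) (@powR R ^~ (- al))).
    by apply: cvgD; [exact: cvg_cst|exact: norm_continuous].
  apply: differentiable_continuous; apply/derivable1_diffP.
  by apply: derivable_powR; rewrite in_itv /= p1.
- by move=> x /=; rewrite normrN.
rewrite -set_itvcy.
pose f (x : R) := (1 + x) `^ (- al).
pose F (x : R) := - (al - 1)^-1 * (1 + x) `^ (- (al - 1)).
have dF x : 0 <= x -> has_deriv F x (f x).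
  move=> x0; have x1 : 0 < 1 + x by rewrite ltr_pwDl.
  have d1 : is_derive x 1 (fun z : R => 1 + z) (1 : R).
    by have := is_deriveD (is_derive_cst (1 : R) x (1 : R)) (is_derive_id x (1 : R));
      rewrite add0r.
  have := @is_derive1_comp _ (@powR R ^~ (- (al - 1))) (fun z : R => 1 + z) _ _ _
    (is_derive1_powR _ x1) d1.
  move/(@is_deriveZ R R R _ (- (al - 1)^-1)).
  rewrite /has_deriv => H; apply: is_derive_eq.
  rewrite /f /GRing.scale /= mulr1 mulrA mulrNN mulVf ?gt_eqF// mul1r.
  by congr (_ `^ _); ring.
rewrite [X in (_ * X)%E](_ : _ =
    \int[@lebesgue_measure R]_(x in `[(0:R)%R, +oo[) (f x)%:E)%E; last first.
  apply: eq_integral => x; rewrite inE /= in_itv /= andbT => x0.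
  by rewrite /f ger0_norm.
have cF x : 0 <= x -> {for x, continuous F}.
  by move=> /dF /has_derivable /derivable1_diffP; exact: differentiable_continuous.
rewrite (@ge0_continuous_FTC2y _ f F 0 0).
- by rewrite sub0e -EFinN -EFinM ltry.
- by move=> x _; exact: powR_ge0.
- apply: continuous_in_subspaceT => x; rewrite inE /= in_itv /= andbT => x0.
  apply: (@continuous_comp _ _ _ (fun x : R => 1 + x) (@powR R ^~ (- al))).
    by apply: cvgD; [exact: cvg_cst|exact: cvg_id].
  apply: differentiable_continuous; apply/derivable1_diffP.
  by apply: derivable_powR; rewrite in_itv /= andbT ltr_pwDl.
- rewrite -(mulr0 (- (al - 1)^-1)); apply: cvgM; first exact: cvg_cst.
  apply/cvgrPdist_lt => e e0; near=> x.
  have x1 : 0 < 1 + x by rewrite ltr_pwDl.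
  rewrite sub0r normrN ger0_norm ?powR_ge0// powRN invf_plt ?posrE ?powR_gt0//.
  (* The threshold solves [x ^ (- (al - 1)) = e]. *)
  have : (e^-1 `^ (al - 1)^-1) < x by near: x; exact: nbhs_pinfty_gt.
  move=> ex; have {}ex : e^-1 `^ (al - 1)^-1 < 1 + x by rewrite (lt_trans ex)// ltrDr.
  have -> : e^-1 = (e^-1 `^ (al - 1)^-1) `^ (al - 1).
    by rewrite -powRrM mulVf ?gt_eqF// powRr1// invr_ge0 ltW.
  by rewrite gt0_ltr_powR// nnegrE ?powR_ge0// ltW.
- by move=> x x0; exact: has_derivable (dF x (ltW x0)).
- by apply: cvg_at_right_filter; exact: cF.
- by move=> x; rewrite in_itv /= andbT => x0; apply: has_deriv_val; apply: dF; exact: ltW.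
Unshelve. all: by end_near. Qed.

(** A real Schwartz function given together with its derivatives: [v i] is the i-th derivative of
    [v 0]. Real and imaginary parts of a complex Schwartz function can then be treated alike. *)
Definition rapidly_decreasing {R : realType} (v : nat -> R -> R) : Prop :=
  (forall i x, has_deriv (v i) x (v i.+1 x)) /\
  forall i j : nat, exists M, forall x, `|x| ^+ i * `|v j x| <= M.

Lemma Schwartz_rpart {R : realType} (psi : R -> R[i]) : Schwartz psi ->
  rapidly_decreasing (fun i => derive1n i (rpart psi)).
Proof.
move=> [dpsi bpsi]; split=> [i x|i j].
  by apply: has_deriv1; have [] := dpsi i.+1 i (ltnSn i) x I.
have [M HM] := bpsi i j; exists M => x; apply: le_trans (HM x).
by rewrite ler_wpM2l ?exprn_ge0//; exact: (abs_Re_le (cderiven j psi x)).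
Qed.

Lemma Schwartz_ipart {R : realType} (psi : R -> R[i]) : Schwartz psi ->
  rapidly_decreasing (fun i => derive1n i (ipart psi)).
Proof.
move=> [dpsi bpsi]; split=> [i x|i j].
  by apply: has_deriv1; have [] := dpsi i.+1 i (ltnSn i) x I.
have [M HM] := bpsi i j; exists M => x; apply: le_trans (HM x).
by rewrite ler_wpM2l ?exprn_ge0//; exact: (abs_Im_le (cderiven j psi x)).
Qed.

Lemma has_deriv_continuous {R : realType} (f : R -> R) x df :
  has_deriv f x df -> {for x, continuous f}.
Proof.
by move=> /has_derivable /derivable1_diffP; exact: differentiable_continuous.
Qed.

Lemma has_deriv_affine {R : realType} (f : R -> R) (c d x df : R) :
  has_deriv f (c * (x - d)) df ->
  has_deriv (fun y => f (c * (y - d))) x (c * df).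
Proof.
move=> dfx.
have dl : is_derive x 1 (fun z : R => c * (z - d)) c.
  have : is_derive x 1 (fun z : R => z - d) (1 : R).
    by apply: is_derive_eq; exact: subr0.
  by move=> H; have := @is_deriveZ R R R _ c x 1 1 H; rewrite /GRing.scale /= mulr1.
by have := @is_derive1_comp _ f (fun z : R => c * (z - d)) _ _ _ dfx dl; rewrite mulrC.
Qed.

Lemma has_derivZ {R : realType} (f : R -> R) (c x df : R) :
  has_deriv f x df -> has_deriv (fun y => c * f y) x (c * df).
Proof. by move=> H; apply: (@is_deriveZ R R R). Qed.

Lemma integral_step_smooth {R : realType} (h a : R) k (v : nat -> R -> R) :
  0 < h -> (forall i x, has_deriv (v i) x (v i.+1 x)) ->
  (@lebesgue_measure R).-integrable setT (EFin \o (fun x => step h k a x * v 0%N x)) /\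
  exists2 xi, a <= xi <= a + k.+1%:R * h &
  \int[@lebesgue_measure R]_x (step h k a x * v 0%N x) = h ^+ k.+1 * v k xi.
Proof.
move=> h0 dv.
apply: (@integral_step_MVT R h k a setT (a - 1) (a + k.+1%:R * h + 1)) => //.
- by rewrite ltrBlDr ltrDl.
- by rewrite ltrDl.
- by move=> x _; exact: has_deriv_continuous (dv 0%N x).
Qed.

(* For small |x| the bound comes from |v 0 z| <= C / (1 + z ^ 2) = C atan' z,
   uniformly in t; for large |x| from k + 1 differences falling on v. *)
Lemma integral_step_dilate_le {R : realType} (h a : R) k (v : nat -> R -> R) :
  0 < h -> 0 < a -> rapidly_decreasing v ->
  exists C, forall t x, 0 < t ->
  `|\int[@lebesgue_measure R]_y (step h k a y * (t^-1 * v 0%N ((x - y) / t)))|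
    * (1 + `|x|) ^+ k.+1 <= C.
Proof.
move=> h0 a0 [dv bv].
have [M0 HM0] := bv 0%N 0%N; have [M2 HM2] := bv 2%N 0%N; have [M HM] := bv k.+1 k.
set b := a + k.+1%:R * h.
have ab : a <= b by rewrite lerDl mulr_ge0 ?ltW.
have b0 : 0 < b := lt_le_trans a0 ab.
have v0le z : `|v 0%N z| <= (M0 + M2) * (1 + z ^+ 2)^-1.
  rewrite ler_pdivlMr ?ltr_pwDl ?sqr_ge0// mulrDr mulr1 lerD//.
    by have := HM0 z; rewrite expr0 mul1r.
  by rewrite mulrC -real_normK ?num_real.
have M020 : 0 <= M0 + M2.
  have := v0le 0; rewrite expr0n addr0 invr1 mulr1; exact: le_trans.
have M_ge0 : 0 <= M by apply: le_trans (HM 0); rewrite mulr_ge0// exprn_ge0.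
have v'_deriv (t x : R) (i : nat) (y : R) :
    has_deriv (fun y => t^-1 * ((- t^-1) ^+ i * v i ((x - y) / t))) y
              (t^-1 * ((- t^-1) ^+ i.+1 * v i.+1 ((x - y) / t))).
  have E (j : nat) : (fun y => v j ((x - y) / t)) = (fun y => v j (- t^-1 * (y - x))).
    by apply/funext => z; congr (v j _); ring.
  rewrite exprSr; apply: has_derivZ; rewrite -mulrA; apply: has_derivZ.
  rewrite E [X in v i.+1 X](_ : _ = - t^-1 * (y - x)); last by ring.
  exact: has_deriv_affine.
(* [pi] bounds the increments of [atan], whatever the scale [t]; the power of 2 counts the
   differences. *)
pose near_bound := ((M0 + M2) * pi) *+ 2 ^ k.
pose far_bound := h ^+ k.+1 * M.
have c1 : 0 <= 1 + 2 * b by lra.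
have c2 : 0 <= 1 + (2 * b)^-1 by rewrite addr_ge0// invr_ge0; lra.
(* For |x| <= 2b the weight is at most (1 + 2b)^(k + 1). For |x| > 2b one has 1 + |x| <= (1 +
   1/(2b)) |x|, and the further factor 2 comes from |x| <= 2 |x - xi|, valid because 0 < xi <= b. *)
exists (near_bound * (1 + 2 * b) ^+ k.+1 +
        far_bound * (2 * (1 + (2 * b)^-1)) ^+ k.+1).
move=> t x t0; set I := `|_|.
have near : I <= near_bound.
  apply: (@integral_step_le R h k a setT _ _
    (fun y => (M0 + M2) * (t^-1 * (1 + ((x - y) / t) ^+ 2)^-1))
    (fun y => - (M0 + M2) * atan (- t^-1 * (y - x)))) => //.
  - move=> y; have := v'_deriv t x 0%N y; rewrite expr0.
    under eq_fun do rewrite mul1r; exact: has_deriv_continuous.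
  - move=> y.
    have -> : (x - y) / t = - t^-1 * (y - x) by ring.
    rewrite -mulrNN -mulNr; apply: has_derivZ.
    exact: (@has_deriv_affine _ _ (- t^-1) x y _ (is_derive1_atan _)).
  - move=> y; rewrite normrM (ger0_norm (x := t^-1)) ?invr_ge0 ?(ltW t0)// mulrCA.
    by rewrite ler_wpM2l ?invr_ge0 ?(ltW t0).
  - move=> y z; set A := - t^-1 * (y - x); set B := - t^-1 * (z - x).
    rewrite (_ : _ - _ = (M0 + M2) * (atan B - atan A)); last by ring.
    rewrite ler_wpM2l//.
    by have := atan_gtNpi2 A; have := atan_ltpi2 B; lra.
have far : 2 * b <= `|x| -> I * `|x| ^+ k.+1 <= far_bound * 2 ^+ k.+1.
  move=> bx; rewrite /I.
  have [_ [xi /andP[axi xib]]] := integral_step_smooth h a k _ h0 (v'_deriv t x).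
  rewrite -/b in xib; under eq_Rintegral do rewrite expr0 mul1r.
  move=> ->.
  have x0 : 0 < `|x| by apply: lt_le_trans bx; rewrite mulr_gt0.
  have xxi : `|x| <= 2 * `|x - xi|.
    have : `|x| <= `|x - xi| + `|xi| by rewrite -[X in `|X| <= _](subrK xi) ler_normD.
    have -> : `|xi| = xi by rewrite ger0_norm// (le_trans (ltW a0)).
    lra.
  (* The factor 1/t of the dilation and the t^-k of its k-th derivative make up the t^-(k + 1) in
     |(x - xi)/t|^(k + 1), so the scale drops out. *)
  have := HM ((x - xi) / t).
  rewrite !normrM !normrX normrN (ger0_norm (ltW h0)) normfV (gtr0_norm t0) exprMn.
  set w := `|v k _| => Hw.
  have w0 : 0 <= w by exact: normr_ge0.
  apply: (@le_trans _ _ (h ^+ k.+1 * (`|x - xi| ^+ k.+1 * t^-1 ^+ k.+1 * w) * 2 ^+ k.+1)).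
    rewrite exprS -!mulrA ler_wpM2l ?(ltW h0)//.
    rewrite ler_wpM2l ?exprn_ge0 ?(ltW h0)//.
    apply: (@le_trans _ _ (t^-1 * (t^-1 ^+ k * (w * (2 * `|x - xi|) ^+ k.+1)))).
      rewrite ler_wpM2l ?invr_ge0 ?(ltW t0)//.
      rewrite ler_wpM2l ?exprn_ge0 ?invr_ge0 ?(ltW t0)//.
      by rewrite ler_wpM2l// lerXn2r ?nnegrE ?mulr_ge0.
    by rewrite exprMn [t^-1 ^+ k.+1]exprS le_eqVlt; apply/orP; left; apply/eqP; ring.
  rewrite /far_bound ler_wpM2r ?exprn_ge0// ler_wpM2l ?exprn_ge0 ?(ltW h0)//.
have I0 : 0 <= I by exact: normr_ge0.
have nb0 : 0 <= near_bound := le_trans I0 near.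
have fb0 : 0 <= far_bound by rewrite mulr_ge0 ?exprn_ge0 ?(ltW h0).
have [xb|bx] := leP `|x| (2 * b).
  apply: (@le_trans _ _ (near_bound * (1 + 2 * b) ^+ k.+1)).
    have x10 : 0 <= 1 + `|x| by rewrite addr_ge0.
    apply: ler_pM; rewrite ?exprn_ge0//.
    by apply: lerXn2r; rewrite ?nnegrE ?lerD2l.
  by rewrite lerDl mulr_ge0// exprn_ge0// mulr_ge0.
have {}far := far (ltW bx).
have x1 : 1 + `|x| <= (1 + (2 * b)^-1) * `|x|.
  rewrite mulrDl mul1r addrC lerD2l mulrC ler_pdivlMr ?mulr_gt0//.
  by rewrite mul1r ltW.
apply: (@le_trans _ _ (far_bound * (2 * (1 + (2 * b)^-1)) ^+ k.+1)); last first.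
  by rewrite lerDr mulr_ge0// exprn_ge0.
apply: (@le_trans _ _ (I * ((1 + (2 * b)^-1) * `|x|) ^+ k.+1)).
  by rewrite ler_wpM2l// lerXn2r ?nnegrE ?addr_ge0// mulr_ge0.
rewrite !exprMn mulrCA mulrC [leRHS]mulrA.
by rewrite ler_wpM2r// exprn_ge0.
Qed.

Definition step_distr {R : realType} (h : R) (k : nat) (a : R) : distr R :=
  fun psi => cintegral setT (fun x => (step h k a x)%:C * psi x).

Lemma represents_step {R : realType} (h : R) k a : 0 < h ->
  represents (step_distr h k a) (fun x => (step h k a x)%:C).
Proof.
move=> h0 psi Spsi; split => //.
rewrite /cintegrable rpart_realM ipart_realM; split.
  exact: (integral_step_smooth h a k _ h0 (Schwartz_rpart _ Spsi).1).1.
exact: (integral_step_smooth h a k _ h0 (Schwartz_ipart _ Spsi).1).1.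
Qed.

Lemma Rintegral_lin3 {R : realType} (a b : R) (f g k : R -> R) :
  (@lebesgue_measure R).-integrable setT (EFin \o f) ->
  (@lebesgue_measure R).-integrable setT (EFin \o g) ->
  (@lebesgue_measure R).-integrable setT (EFin \o k) ->
  \int[@lebesgue_measure R]_x (a * f x + b * g x + k x) =
  a * \int[@lebesgue_measure R]_x f x + b * \int[@lebesgue_measure R]_x g x
    + \int[@lebesgue_measure R]_x k x.
Proof.
move=> jf jg jk.
have ja : (@lebesgue_measure R).-integrable setT (EFin \o (fun x => a * f x)).
  exact: (@integrableZl _ _ _ (@lebesgue_measure R) setT measurableT a _ jf).
have jb : (@lebesgue_measure R).-integrable setT (EFin \o (fun x => b * g x)).
  exact: (@integrableZl _ _ _ (@lebesgue_measure R) setT measurableT b _ jg).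
rewrite RintegralD//; last first.
  exact: (@integrableD _ _ _ (@lebesgue_measure R) setT measurableT _ _ ja jb).
by rewrite RintegralD// !RintegralZl.
Qed.

Lemma tempered_step {R : realType} (h : R) k a : 0 < h ->
  tempered (step_distr h k a).
Proof.
move=> h0; split.
  move=> z psi1 psi2 S1 S2.
  have [] := represents_step h k a h0 psi1 S1.
  have [] := represents_step h k a h0 psi2 S2.
  rewrite /step_distr /cintegral /cintegrable !rpart_realM !ipart_realM.
  move=> [r2 i2] _ [r1 i1] _.
  pose psi x := z * psi1 x + psi2 x.
  have rE : (fun x => step h k a x * rpart psi x) = fun x =>
      complex.Re z * (step h k a x * rpart psi1 x)
      + (- complex.Im z) * (step h k a x * ipart psi1 x)
      + step h k a x * rpart psi2 x.
    apply/funext => x; rewrite /psi /rpart /ipart.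
    by case: (z) (psi1 x) (psi2 x) => [u v] [u1 v1] [u2 v2] /=; ring.
  have iE : (fun x => step h k a x * ipart psi x) = fun x =>
      complex.Re z * (step h k a x * ipart psi1 x)
      + complex.Im z * (step h k a x * rpart psi1 x)
      + step h k a x * ipart psi2 x.
    apply/funext => x; rewrite /psi /rpart /ipart.
    by case: (z) (psi1 x) (psi2 x) => [u v] [u1 v1] [u2 v2] /=; ring.
  rewrite rE iE.
  rewrite !Rintegral_lin3//.
  case: (z) => u v;
  apply/eqP; rewrite eq_complex /=.
  by apply/andP; split; apply/eqP; ring.
(* Real and imaginary parts of the value are h^(k + 1) times k-th derivatives, at two different
   points; hence the order k and the factor 2. *)
exists k, (2 * h ^+ k.+1); move=> psi M Spsi HM.
have [_ [xi _ E1]] := integral_step_smooth h a k _ h0 (Schwartz_rpart _ Spsi).1.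
have [_ [xi' _ E2]] := integral_step_smooth h a k _ h0 (Schwartz_ipart _ Spsi).1.
rewrite /step_distr /cintegral rpart_realM ipart_realM (le_trans (normc_le _))//=.
rewrite E1 E2 -mulrA mulr2n mulrDl mul1r.
have H0 (x : R) : normc (cderiven k psi x) <= M.
  by have := HM 0%N k x (leq0n k) (leqnn k); rewrite expr0 mul1r.
rewrite !normrM (ger0_norm (exprn_ge0 _ (ltW h0))).
rewrite lerD// ler_wpM2l ?exprn_ge0 ?(ltW h0)//.
  exact: le_trans (abs_Re_le (cderiven k psi xi)) (H0 _).
exact: le_trans (abs_Im_le (cderiven k psi xi')) (H0 _).
Qed.

Lemma supported_step {R : realType} (X : set R) (h : R) k a : 0 < h ->
  `[a, a + k.+1%:R * h] `<=` X -> supported_in X (step_distr h k a).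
Proof.
move=> h0 IX psi _ _ disj; rewrite /step_distr.
rewrite (_ : (fun x => _) = fun=> 0).
  by rewrite /cintegral /rpart /ipart /= Rintegral_cst// mul0r.
apply/funext => x; have [xI|xI] := boolP (a <= x <= a + k.+1%:R * h); last first.
  by rewrite step_supp ?(ltW h0)// mul0r.
have [->|psix] := eqVneq (psi x) 0; first by rewrite mulr0.
suff : set0 x by [].
rewrite -disj; split; first exact: subset_closure.
by apply: subset_closure; apply: IX; rewrite /= in_itv.
Qed.

(** [1 < k.+1%:R * p] is the integrability at infinity of [(1 + |x|)^(-(k + 1) p)], the p-th power
    of the bound on the maximal function. *)
Lemma HpX_step {R : realType} (Phi : R -> R[i]) (p : R) (X : set R) (h : R) k a :
  Schwartz Phi -> 0 < p -> 1 < k.+1%:R * p -> 0 < h -> 0 < a ->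
  `[a, a + k.+1%:R * h] `<=` X -> HpX Phi p X (step_distr h k a).
Proof.
move=> SPhi p0 kp h0 a0 IX; split; last exact: supported_step.
split; first exact: tempered_step.
have [C1 HC1] := integral_step_dilate_le h a k _ h0 a0 (Schwartz_rpart _ SPhi).
have [C2 HC2] := integral_step_dilate_le h a k _ h0 a0 (Schwartz_ipart _ SPhi).
have C0 : 0 <= C1 + C2.
  apply: addr_ge0; [apply: le_trans (HC1 1 0 ltr01)|apply: le_trans (HC2 1 0 ltr01)];
  by rewrite mulr_ge0 ?exprn_ge0// normr0 addr0.
have H x : (maximal Phi (step_distr h k a) x <=
    ((C1 + C2) * (1 + `|x|) `^ (- k.+1%:R))%:E)%E.
  apply: ge_ereal_sup => _ [t t0 <-]; rewrite lee_fin.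
  have x1 : 0 < 1 + `|x| by rewrite ltr_pwDl.
  rewrite powRN powR_mulrn ?(ltW x1)// ler_pdivlMr ?exprn_gt0//.
  apply: (le_trans (ler_wpM2r (exprn_ge0 _ (ltW x1)) (normc_le _))).
  rewrite mulrDl; apply: lerD.
    apply: le_trans (HC1 t x t0).
    by rewrite /convol /dilate /step_distr /cintegral rpart_realM /= rpart_realM.
  apply: le_trans (HC2 t x t0).
  by rewrite /convol /dilate /step_distr /cintegral ipart_realM /= ipart_realM.
apply: (@le_lt_trans _ _ (\int[@lebesgue_measure R]_x
  (((C1 + C2) `^ p)%:E * ((1 + `|x|) `^ (- (k.+1%:R * p)))%:E)))%E.
  apply: ge0_le_integralT => x; first exact: poweR_ge0.
  have x1 : 0 < 1 + `|x| by rewrite ltr_pwDl.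
  rewrite -EFinM -mulNr powRrM -powRM ?powR_ge0// -poweR_EFin.
  apply: gt0_ler_poweR; rewrite ?in_itv /= ?leey ?andbT ?(ltW p0)//.
    apply: (@le_trans _ _ (normc (convol (step_distr h k a) (dilate Phi 1) x))%:E).
      by rewrite lee_fin (le_trans (normr_ge0 _) (abs_Re_le _)).
    by apply: ereal_sup_ubound; exists 1 => //=.
  by rewrite lee_fin mulr_ge0 ?powR_ge0.
rewrite ge0_integralZl//; last 2 first.
- apply: (measurableT_comp (@EFin_measurable R setT)).
  apply: (measurableT_comp (measurable_powR _)).
  by apply: measurable_funD => //; exact: normr_measurable.
- by rewrite lee_fin powR_ge0.
rewrite lte_mul_pinfty ?lee_fin ?powR_ge0//; exact: integral_powR_fin.
Qed.

(** * Atoms *)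

Lemma Lnorm_supported_le {R : realType} (q : \bar R) (B : set R) (L c : R)
    (g : R -> R) : (1 <= q)%E -> measurable B ->
  lebesgue_measure B = L%:E -> 0 < L -> 0 <= c ->
  (forall x, `|g x| <= c * \1_B x) ->
  (Lnorm (@lebesgue_measure R) q (EFin \o g) <= (c * L `^ fine q^-1)%:E)%E.
Proof.
move=> q1 mB muB L0 c0 gB; rewrite unlock; case: q q1 => [r|_|]; last by [].
- rewrite lee_fin => r1; have r0 : 0 < r := lt_le_trans ltr01 r1.
  rewrite inver gt_eqF//=.
  apply: (@le_trans _ _ ((c `^ r * L)%:E `^ r^-1)%E); last first.
    by rewrite poweR_EFin powRM ?powR_ge0 ?(ltW L0)// -powRrM mulfV ?gt_eqF// powRr1.
  apply: gt0_ler_poweR; rewrite ?invr_ge0 ?(ltW r0)// ?in_itv /= ?leey ?andbT.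
  + by apply: integral_ge0 => x _; rewrite lee_fin powR_ge0.
  + by rewrite lee_fin mulr_ge0 ?powR_ge0 ?(ltW L0).
  apply: (@le_trans _ _ (\int[@lebesgue_measure R]_x ((c `^ r)%:E * (\1_B x)%:E))%E).
    apply: ge0_le_integralT => x; first by rewrite lee_fin powR_ge0.
    rewrite -EFinM lee_fin; move: (gB x); rewrite indicE.
    have [xB|xB] := boolP (x \in B); rewrite ?mulr1 ?mulr0 => gx.
      by apply: ge0_ler_powR; rewrite ?nnegrE ?(ltW r0).
    have -> : g x = 0 by apply/eqP; rewrite -normr_le0.
    by rewrite normr0 powR0 ?gt_eqF.
  rewrite ge0_integralZl//; last 2 first.
  + by apply: (measurableT_comp (@EFin_measurable R setT)); exact: measurable_indic.
  + by rewrite lee_fin powR_ge0.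
  rewrite [X in (_ * X)%E](_ : _ = L%:E) ?EFinM//.
  by rewrite integral_indic// setIT; exact: muB.
- rewrite invey /= powRr0 mulr1; case: ifPn => _; last by rewrite lee_fin.
  apply/ess_sup_inf.ess_supP/aeW => x /=; rewrite lee_fin (le_trans (gB x))// ler_piMr//.
Qed.

(** With falling factorials one formula covers all orders: the coefficient vanishes once the order
    exceeds [i], where [i - j] is truncated. *)
Lemma has_deriv_monomial {R : realType} (c : R) (i j : nat) (x : R) :
  has_deriv (fun x => c * ((i ^_ j)%:R * x ^+ (i - j))) x
    (c * ((i ^_ j.+1)%:R * x ^+ (i - j.+1))).
Proof.
apply: has_derivZ; rewrite ffactnSr natrM -mulrA; apply: has_derivZ.
have := @is_deriveX R R (@id R) (i - j) x 1 1 (is_derive_id _ _).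
rewrite /GRing.scale /= mulr1 subnS (_ : id ^+ (i - j) = fun y : R => y ^+ (i - j))//.
by apply/funext => y; rewrite exprfctE.
Qed.

(** The factor turns [|step| <= 2^k] into the sup bound L^(-1/p) on an interval of length L = (k +
    1) h, and this implies the size condition for every q at once. The moments of degree i < k
    vanish because the k-th derivative of x^i does. *)
Lemma atom_step {R : realType} (p : R) (q : \bar R) (X : set R) (h : R) k a :
  (1 <= q)%E -> 0 < p -> (Num.truncn (p^-1 - 1) < k)%N -> 0 < h ->
  `[a, a + k.+1%:R * h] `<=` X ->
  atom p q X (fun x => ((2 ^+ k * (k.+1%:R * h) `^ p^-1)^-1 * step h k a x)%:C).
Proof.
move=> q1 p0 Pk h0 IX; set L := k.+1%:R * h in IX *; set r := (_ * _)^-1.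
have L0 : 0 < L by rewrite mulr_gt0.
have r0 : 0 < r by rewrite invr_gt0 mulr_gt0 ?exprn_gt0 ?powR_gt0.
pose B : set R := [set` `[a, a + L]].
have muB : lebesgue_measure B = L%:E.
  rewrite lebesgue_measure_itv /= lte_fin ltrDl L0 -EFinB; congr EFin; ring.
split.
  split.
    apply: measurable_funM; [exact: measurable_cst|exact: measurable_step].
  exact: measurable_cst.
exists B; split; [split|split].
- exact: interval_is_interval.
- by apply: compact_bounded; exact: segment_compact.
- by rewrite muB lte_fin.
- exact: IX.
- move=> x xB; rewrite step_supp ?(ltW h0) ?mulr0//.
  by apply/negP => xI; apply: xB; rewrite /B /= in_itv.
- have E : (fun x => (normc ((r * step h k a x)%:C))%:E) =
      EFin \o (fun x => `|r * step h k a x|).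
    by apply/funext => x; rewrite normc_real.
  rewrite E muB /=.
  apply: (le_trans (@Lnorm_supported_le R q B L (L `^ (- p^-1)) _ q1 _ muB L0 _ _)).
  + exact: measurable_itv.
  + exact: powR_ge0.
  + move=> x; rewrite normr_id indicE.
    have [xI|xI] := boolP (a <= x <= a + L); last first.
      by rewrite step_supp ?(ltW h0)// mulr0 normr0 mulr_ge0 ?powR_ge0.
    rewrite mem_set ?mulr1; last by rewrite /B /= in_itv.
    rewrite normrM (gtr0_norm r0) /r powRN invfM -mulrA mulrCA ler_piMr ?invr_ge0 ?powR_ge0//.
    by rewrite mulrC ler_pdivrMr ?exprn_gt0// mul1r step_le.
  by rewrite lee_fin addrC powRD// (gt_eqF L0) implybT.
- move=> i iP; rewrite /cintegral.
  have -> : (fun x => (r * step h k a x)%:C * (x ^+ i)%:C) =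
      (fun x => (step h k a x * (r * ((i ^_ 0)%:R * x ^+ (i - 0))))%:C).
    apply/funext => x; rewrite -rmorphM; congr _%:C.
    by rewrite ffactn0 subn0; ring.
  have -> : ipart (fun x => (step h k a x * (r * ((i ^_ 0)%:R * x ^+ (i - 0))))%:C) = cst 0.
    by [].
  rewrite /rpart /= Rintegral_cst ?mul0r; last exact: measurable_itv.
  have [|||||_ [xi _]] := @integral_step_MVT R h k a B (a - 1) (a + L + 1)
    (fun j x => r * ((i ^_ j)%:R * x ^+ (i - j))) h0 (measurable_itv _).
  + by [].
  + by rewrite ltrBlDr ltrDl.
  + by rewrite ltrDl.
  + by move=> x _; exact: has_deriv_continuous (has_deriv_monomial r i 0 x).
  + by move=> j x _ _; exact: has_deriv_monomial.
  rewrite /= (ffact_small (leq_ltn_trans iP Pk)) mul0r !mulr0 => E.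
  by rewrite -[RHS]/(0 +i* 0); congr (_ +i* _).
Qed.

Lemma Hp_norm_step_le {R : realType} (p : R) (q : \bar R) (X : set R) (h : R) k a :
  (1 <= q)%E -> 0 < p -> (Num.truncn (p^-1 - 1) < k)%N -> 0 < h ->
  `[a, a + k.+1%:R * h] `<=` X ->
  (Hp_norm p q X (step_distr h k a) <= (2 ^+ k * (k.+1%:R * h) `^ p^-1)%:E)%E.
Proof.
move=> q1 p0 Pk h0 IX; set l := 2 ^+ k * _.
have l0 : 0 < l by rewrite mulr_gt0 ?exprn_gt0 ?powR_gt0 ?mulr_gt0.
(* A decomposition is an infinite sequence all of whose members must be atoms, so one atom is
   repeated with coefficient 0. *)
pose lam (j : nat) : R[i] := if j is 0 then l%:C else 0.
pose at_ (j : nat) x := (l^-1 * step h k a x)%:C.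
have sumE : (\sum_(0 <= j <oo) (normc (lam j) `^ p)%:E = (l `^ p)%:E)%E.
  rewrite (nneseries_split 0 1); last by move=> j _; rewrite lee_fin powR_ge0.
  rewrite add0n big_nat1 {1}/lam normc_real (gtr0_norm l0) eseries0 ?adde0//.
  by move=> [//|j] _ _; rewrite /= expr0n /= addr0 sqrtr0 powR0 ?gt_eqF.
rewrite /Hp_norm; apply: ereal_inf_lbound; exists lam, at_; split; last first.
  by rewrite sumE poweR_EFin -powRrM mulfV ?gt_eqF// powRr1// ltW.
split.
- by move=> j; exact: atom_step.
- by rewrite sumE ltry.
move=> psi Spsi; rewrite /cconv; apply: cvg_near_cst; exists 1%N => // n /= n1.
case: n n1 => // n _; rewrite big_ord_recl /= big1 ?addr0; last by move=> j _; rewrite mul0r.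
have [[ir ii] _] := represents_step h k a h0 psi Spsi.
rewrite rpart_realM in ir; rewrite ipart_realM in ii.
have -> : cintegral setT (fun x => at_ 0%N x * psi x) = l^-1%:C * step_distr h k a psi.
  rewrite /step_distr /cintegral /at_ !rpart_realM !ipart_realM.
  under eq_Rintegral do rewrite -mulrA.
  under [X in _ +i* X]eq_Rintegral do rewrite -mulrA.
  rewrite !RintegralZl//;
  apply/eqP; rewrite eq_complex /=.
  by apply/andP; split; apply/eqP; ring.
rewrite mulrA -rmorphM mulfV ?gt_eqF// mul1r subrr.
by rewrite /= expr0n /= addr0 sqrtr0.
Qed.

(** * Lower bounds for the pairing *)

Lemma rpart_conj {R : realType} (g : R -> R[i]) :
  rpart (fun x => (g x)^*) = rpart g.
Proof. by apply/funext => x; rewrite /rpart; case: (g x). Qed.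

Lemma ipart_conj {R : realType} (g : R -> R[i]) :
  ipart (fun x => (g x)^*) = (fun x => - ipart g x).
Proof. by apply/funext => x; rewrite /ipart; case: (g x). Qed.

Lemma constant_sign_normc {R : realType} (D : set R) (g : R -> R[i]) x :
  constant_sign D g -> D x -> normc (g x) = `|complex.Re (g x)|.
Proof.
move=> gD Dx; have : complex.Im (g x) = 0.
  by case: gD => /(_ _ Dx); rewrite lecE /= => /andP[/eqP].
by case: (g x) => a b /= ->; rewrite expr0n /= addr0 sqrtr_sqr.
Qed.

(** Real and imaginary parts would have different mean value points, so only the real part of the
    pairing is estimated. Nothing is lost: by [constant_sign] the derivative is real, and its real
    part at [xi] has the full modulus. *)
Lemma pairing_step_ge {R : realType} (p : R) (q : \bar R) (X : set R) (n : nat)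
    (h hi l : R) (phi : R -> R[i]) :
  open X -> `]0, hi[ `<=` X -> 0 < h -> n.+2%:R * h < hi ->
  (0 < n)%N -> ndifferentiable X n phi ->
  constant_sign `]0, hi[ (cderiven n phi) ->
  (forall u, h <= u <= n.+2%:R * h -> l <= normc (cderiven n phi u)) ->
  h ^+ n.+1 * l <= normc (pairing p q X (step_distr h n h) phi).
Proof.
move=> oX IX h0 hhi n0 dphi sphi phil.
have mX : measurable X by exact: open_measurable.
have hE : h + n.+1%:R * h = n.+2%:R * h by rewrite -[n.+2%:R]natr1 mulrDl mul1r addrC.
have IX' : `[h, h + n.+1%:R * h] `<=` X.
  rewrite hE => x; rewrite /= in_itv /= => /andP[hx xh]; apply: IX.
  by rewrite /= in_itv /= (lt_le_trans h0 hx) (le_lt_trans xh hhi).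
have hhi' : h + n.+1%:R * h < hi by rewrite hE.
have dr i x : (i < n)%N -> 0 < x < hi ->
    has_deriv (derive1n i (rpart phi)) x (derive1n i.+1 (rpart phi) x).
  move=> ni x0; apply: has_deriv1.
  by have [] := dphi i ni x; first by apply: IX; rewrite /= in_itv.
have di i x : (i < n)%N -> 0 < x < hi ->
    has_deriv (derive1n i (ipart phi)) x (derive1n i.+1 (ipart phi) x).
  move=> ni x0; apply: has_deriv1.
  by have [] := dphi i ni x; first by apply: IX; rewrite /= in_itv.
have [|ir [xi xiI Er]] := @integral_step_MVT R h n h X 0 hi
  (fun i => derive1n i (rpart phi)) h0 mX IX' h0 hhi' _ dr.
  by move=> x; rewrite in_itv => xI; exact: has_deriv_continuous (dr 0%N x n0 xI).
have [|ii _] := @integral_step_MVT R h n h X 0 hi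
  (fun i => derive1n i (ipart phi)) h0 mX IX' h0 hhi' _ di.
  by move=> x; rewrite in_itv => xI; exact: has_deriv_continuous (di 0%N x n0 xI).
rewrite hE in xiI.
rewrite (@pairing_represents R p q X _ phi (fun x => (step h n h x)%:C))//; last 2 first.
- exact: represents_step.
- rewrite /cintegrable rpart_realM ipart_realM rpart_conj ipart_conj; split => //.
  rewrite (_ : EFin \o _ = (fun x => - (step h n h x * ipart phi x)%:E)%E); last first.
    by apply/funext => x /=; rewrite mulrN EFinN.
  exact: (@integrableN _ _ _ (@lebesgue_measure R) X _ ii).
apply: le_trans (abs_Re_le (inner _ _ _)); rewrite /inner /cintegral rpart_realM rpart_conj.
rewrite [complex.Re _]Er normrM ger0_norm ?exprn_ge0 ?(ltW h0)//.
rewrite ler_wpM2l ?exprn_ge0 ?(ltW h0)//.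
have xi0 : [set` `]0, hi[] xi.
  by case/andP: xiI => a b; rewrite /= in_itv /= (lt_le_trans h0 a) (le_lt_trans b hhi).
by rewrite (le_trans (phil _ xiI))// (constant_sign_normc _ _ _ sphi xi0).
Qed.

(** * Comparison and balancing of powers *)

(** The exponent may have either sign: for [th >= 0] monotonicity suffices, for [th < 0] the loss is
    [A ^ th]. *)
Lemma powR_comparable {R : realType} (x y A th : R) : 0 < x -> 1 <= A ->
  x <= y <= A * x -> A `^ (- `|th|) * x `^ th <= y `^ th.
Proof.
move=> x0 A1 /andP[xy yAx].
have y0 : 0 < y := lt_le_trans x0 xy; have A0 : 0 < A := lt_le_trans ltr01 A1.
have [th0|th0] := leP 0 th.
  apply: (@le_trans _ _ (x `^ th)); last first.
    by apply: ge0_ler_powR; rewrite ?nnegrE ?(ltW x0) ?(ltW y0).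
  by rewrite ler_piMl ?powR_ge0// -[leRHS](powRr0 A) ler_powR// oppr_le0.
rewrite ltr0_norm// opprK -powRM ?(ltW A0) ?(ltW x0)//.
rewrite -(opprK th) [leLHS]powRN [leRHS]powRN.
rewrite lef_pV2 ?posrE ?powR_gt0 ?mulr_gt0//.
apply: ge0_ler_powR; rewrite ?nnegrE ?oppr_ge0 ?(ltW th0) ?(ltW y0)//.
by rewrite mulr_ge0 ?(ltW A0) ?(ltW x0).
Qed.

Lemma powR_unbounded {R : realType} (e D : R) : 0 < e ->
  exists2 N : nat, (0 < N)%N & D < N%:R `^ e.
Proof.
move=> e0; pose y := `|D| `^ e^-1.
exists (Num.truncn y).+1 => //.
have y0 : 0 <= y by exact: powR_ge0.
have yN : y < (Num.truncn y).+1%:R by have /andP[] := truncn_itv y0.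
apply: (@le_lt_trans _ _ (y `^ e)).
  by rewrite -powRrM mulVf ?gt_eqF// powRr1// ler_norm.
by apply: gt0_ltr_powR; rewrite ?nnegrE.
Qed.

(** Dividing by [h ^ (r s)] leaves [h ^ (s (n + b - r))] on the left; since [h] is [h1] times
    [x ^ (- 2 g)], the powers of [x] add up to [eps]. *)
Lemma power_balance {R : realType} (n : nat) (s r g b th eps x h1 m B C D : R) :
  0 < x -> 0 < h1 -> 0 <= m -> 0 <= D ->
  1 + th - 2 * g * (s * (n%:R + b - r)) = eps ->
  let h := h1 * x `^ (- (2 * g)) in
  x * (B * x `^ th) * (h ^+ n * (m * h `^ b)) `^ s
    <= C * (D * (n%:R * h) `^ r) `^ s ->
  x `^ eps * (B * m `^ s * h1 `^ (s * (n%:R + b - r))) <= C * (D * n%:R `^ r) `^ s.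
Proof.
move=> x0 h10 m0 D0 <- h.
have h0 : 0 < h by rewrite mulr_gt0 ?powR_gt0.
have hE : h `^ (s * (n%:R + b - r)) =
    h1 `^ (s * (n%:R + b - r)) * x `^ (- (2 * g) * (s * (n%:R + b - r))).
  by rewrite /h powRM ?powR_ge0 ?(ltW h10)// -powRrM.
have xE : x `^ (1 + th - 2 * g * (s * (n%:R + b - r))) =
    x * x `^ th * x `^ (- (2 * g) * (s * (n%:R + b - r))).
  have xD u v : x `^ (u + v) = x `^ u * x `^ v.
    by rewrite powRD// (gt_eqF x0) implybT.
  by rewrite !xD (powRr1 (ltW x0)) !mulNr.
clearbody h.
have -> : h ^+ n * (m * h `^ b) = m * h `^ (n%:R + b).
  rewrite powRD; last by rewrite (gt_eqF h0) implybT.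
  by rewrite powR_mulrn ?(ltW h0)//; ring.
have -> : (m * h `^ (n%:R + b)) `^ s =
    m `^ s * (h `^ (s * (n%:R + b - r)) * h `^ (r * s)).
  rewrite powRM ?powR_ge0// -powRrM -powRD; last by rewrite (gt_eqF h0) implybT.
  by congr (_ * _ `^ _); ring.
have -> : (D * (n%:R * h) `^ r) `^ s = (D * n%:R `^ r) `^ s * h `^ (r * s).
  rewrite (powRM r (ler0n R n) (ltW h0)) mulrA powRM ?mulr_ge0 ?powR_ge0//.
  by rewrite -powRrM.
have hrs : 0 < h `^ (r * s) by rewrite powR_gt0.
move=> H; rewrite -(ler_pM2r hrs) -[leRHS]mulrA; apply: le_trans H.
by rewrite hE xE le_eqVlt; apply/orP; left; apply/eqP; ring.
Qed.

(** * Sharpness of the exponent *)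

Theorem proposition2p7 (R : realType)
  (Phi : R -> R[i]) (hPhi : Schwartz Phi) (hPhi0 : cintegral setT Phi != 0)
  (p s : R) (hp0 : 0 < p) (hp1 : p <= 1) (hps : p <= s) (hs2 : s <= 2)
  (q : \bar R) (hq1 : (1 <= q)%E) (hpq : (p%:E < q)%E)
  (P : nat) (hP : P = Num.truncn (p^-1 - 1))
  (X : set R) (hXopen : open X) (hXint : is_interval X)
  (c : R) (hc : 0 < c) (hcX : `]0, c[ `<=` X)
  (phi : nat -> R -> R[i])
  (hphi : orthonormal_basis X phi)
  (hphiLip : forall k, LipX X (p^-1 - 1) (phi k))
  (ker : R -> R -> R -> R[i])
  (hker : forall r : R, 0 < r < 1 -> is_Abel_kernel X phi r (ker r))
  (hkerC : forall r : R, 0 < r < 1 -> forall y, X y ->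
     class_C X P (fun x => ker r x y))
  (gamma : R) (hgamma : 0 < gamma)
  (Delta : {fset R})
  (hDelta : forall d, d \in Delta -> 0 < d /\ p^-1 - 1 - P%:R < d)
  (hkerHolder : forall k : nat, (k <= P)%N -> exists Ck : R,
     forall r : R, 0 < r < 1 -> forall x x', X x -> X x' -> `|x - x'| <= 2^-1 ->
       (L2norm X (fun y => ker r x y -
          \sum_(0 <= i < k.+1)
             cderiven i (fun z => ker r z y) x' / (i`!)%:R
               * ((x - x') ^+ i)%:C)%R
        <= (Ck * \sum_(d <- Delta)
              (1 - r) `^ (- ((1 + 2 * k%:R + 2 * d) * gamma))
              * `|x - x'| `^ (k%:R + d))%:E)%E)
  (hphiD : forall k, ndifferentiable X P.+1 (phi k))
  (tau : R)
  (htau : (4 * gamma - 2 * p * gamma - p) / (2 * p) < tau)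
  (m M : R) (hm : 0 < m) (hmM : m <= M)
  (hphibound : forall K k : nat, (1 <= K)%N -> (k <= K)%N ->
     forall u : R, 0 < u < c * K%:R `^ (- (2 * gamma)) ->
       m * k.+1%:R `^ tau
         * u `^ ((1 + 2 * tau - 2 * gamma) / (4 * gamma) - P.+1%:R)
         <= normc (cderiven P.+1 (phi k) u) /\
       normc (cderiven P.+1 (phi k) u)
         <= M * k.+1%:R `^ tau
              * u `^ ((1 + 2 * tau - 2 * gamma) / (4 * gamma) - P.+1%:R))
  (hphisign : forall K k : nat, (1 <= K)%N -> (k <= K)%N ->
     constant_sign `]0, c * K%:R `^ (- (2 * gamma))[
       (cderiven P.+1 (phi k))) :
  let E := (2 - p) * s * gamma / p + (2 - s) / 2 in
  forall eps : R, 0 < eps ->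
    ~ exists C : R, forall F : distr R, HpX Phi p X F ->
        (\sum_(0 <= k <oo)
            (normc (pairing p q X F (phi k)) `^ s
               * k.+1%:R `^ (- (E - eps)))%:E
         <= C%:E * (Hp_norm p q X F `^ s))%E.
Proof.
move=> E eps eps0 [C HC].
have s0 : 0 < s := lt_le_trans hp0 hps.
have p10 : 0 <= p^-1 - 1 by rewrite subr_ge0 invf_ge1.
pose n := P.+1.
have Pn : (Num.truncn (p^-1 - 1) < n)%N by rewrite -hP.
have np : 1 < n.+1%:R * p.
  rewrite -ltr_pdivrMr// mul1r -natr1 -ltrBlDr.
  by have /andP[_] := truncn_itv p10; rewrite -hP.
pose b := (1 + 2 * tau - 2 * gamma) / (4 * gamma) - n%:R.
(* [kap] is the loss in comparing u^b with h^b for h <= u <= (n + 2) h. [th] collects the powers of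
   k + 1: tau s from the lower bound, -(E - eps) from the weight. *)
pose kap := n.+2%:R `^ (- `|b|) : R.
pose th := tau * s - (E - eps).
(* The hypothesis is used with K = 2N. Dividing by n + 3 places the right end (n + 2) h of the
   support strictly inside (0, c K^(-2 gamma)). *)
pose hh (N : nat) := c / n.+3%:R * (N.*2)%:R `^ (- (2 * gamma)).
have kap0 : 0 < kap by rewrite powR_gt0.
have hh0 N : (0 < N)%N -> 0 < hh N.
  by move=> N0; rewrite mulr_gt0 ?powR_gt0 ?divr_gt0// ltr0n double_gt0.
have key (N : nat) : (0 < N)%N ->
    N%:R * (2 `^ (- `|th|) * N%:R `^ th)
      * (hh N ^+ n.+1 * (m * (kap * hh N `^ b))) `^ s
    <= `|C| * (2 ^+ n * (n.+1%:R * hh N) `^ p^-1) `^ s.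
  move=> N0; have h0 := hh0 N N0; set h := hh N in h0 *.
  pose hi := c * (N.*2)%:R `^ (- (2 * gamma)).
  have K1 : (1 <= N.*2)%N by rewrite double_gt0.
  have KR1 : 1 <= (N.*2)%:R :> R by rewrite ler1n.
  have hihE : hi = n.+3%:R * h.
    by rewrite /h /hh /hi mulrA mulrCA mulfV ?mulr1.
  have hhi : n.+2%:R * h < hi by rewrite hihE ltr_pM2r// ltr_nat.
  have hic : hi <= c.
    rewrite ler_piMr ?(ltW hc)// -[leRHS](powRr0 (N.*2)%:R) ler_powR//.
    by rewrite oppr_le0 mulr_ge0 ?(ltW hgamma).
  have hiX : `]0, hi[ `<=` X.
    move=> x; rewrite /= in_itv /= => /andP[x0 xhi]; apply: hcX.
    by rewrite /= in_itv /= x0 (lt_le_trans xhi).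
  have IX : `[h, h + n.+1%:R * h] `<=` X.
    move=> x; rewrite /= in_itv /= => /andP[hx xh]; apply: hiX.
    rewrite /= in_itv /= (lt_le_trans h0 hx) (le_lt_trans xh)//.
    by move: hhi; rewrite -[n.+2%:R]natr1 mulrDl mul1r addrC.
  have HF := HC _ (@HpX_step R Phi p X h n h hPhi hp0 np h0 h0 IX).
  have Hn := @Hp_norm_step_le R p q X h n h hq1 hp0 Pn h0 IX.
  have low k : (N <= k < N.*2)%N ->
      2 `^ (- `|th|) * N%:R `^ th * (h ^+ n.+1 * (m * (kap * h `^ b))) `^ s <=
      normc (pairing p q X (step_distr h n h) (phi k)) `^ s
        * k.+1%:R `^ (- (E - eps)).
    move=> /andP[Nk kK].
    have k10 : 0 < k.+1%:R :> R by [].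
    have pk : h ^+ n.+1 * (m * k.+1%:R `^ tau * (kap * h `^ b)) <=
        normc (pairing p q X (step_distr h n h) (phi k)).
      apply: (@pairing_step_ge R p q X n h hi) => //.
        exact: (hphisign N.*2 k K1 (ltnW kK)).
      move=> u /andP[hu uh]; have u0 : 0 < u := lt_le_trans h0 hu.
      have [|H _] := hphibound N.*2 k K1 (ltnW kK) u.
        by rewrite u0 (le_lt_trans uh hhi).
      apply: le_trans H; rewrite ler_wpM2l ?mulr_ge0 ?powR_ge0 ?(ltW hm)//.
      by apply: powR_comparable; rewrite ?ler1n// hu.
    have kh0 : 0 <= kap * h `^ b := mulr_ge0 (ltW kap0) (powR_ge0 _ _).
    have hn0 : 0 <= h ^+ n.+1 := exprn_ge0 _ (ltW h0).
    have g0 := mulr_ge0 hn0 (mulr_ge0 (ltW hm) kh0).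
    apply: (@le_trans _ _
      ((h ^+ n.+1 * (m * k.+1%:R `^ tau * (kap * h `^ b))) `^ s
       * k.+1%:R `^ (- (E - eps)))); last first.
      rewrite ler_wpM2r ?powR_ge0//; apply: ge0_ler_powR => //; first exact: ltW.
        rewrite nnegrE; apply: mulr_ge0 => //; apply: mulr_ge0 => //.
        exact: mulr_ge0 (ltW hm) (powR_ge0 _ _).
      by rewrite nnegrE (le_trans (normr_ge0 _) (abs_Re_le _)).
    have -> : h ^+ n.+1 * (m * k.+1%:R `^ tau * (kap * h `^ b)) =
       k.+1%:R `^ tau * (h ^+ n.+1 * (m * (kap * h `^ b))) by ring.
    move: (h ^+ n.+1 * _) g0 => G g0.
    rewrite powRM ?powR_ge0// -powRrM [leRHS]mulrAC ler_wpM2r ?powR_ge0// -powRD; last first.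
      by rewrite (gt_eqF k10) implybT.
    (* Here k < 2N enters as k + 1 <= 2N, so the ratio of k + 1 to N is at most 2. *)
    apply: powR_comparable; rewrite ?ltr0n ?ler1n//.
    rewrite ler_nat (leq_trans Nk)//=.
    by rewrite -natrM ler_nat mul2n.
  rewrite -lee_fin; apply: le_trans (le_trans HF _); last first.
    (* [C] might be negative; with its absolute value the right-hand side is monotone in the norm,
       which is only known from above. *)
    rewrite EFinM; apply: (@le_trans _ _
      (`|C|%:E * (Hp_norm p q X (step_distr h n h) `^ s))%E).
      by rewrite lee_wpmul2r ?poweR_ge0// lee_fin ler_norm.
    rewrite lee_wpmul2l ?lee_fin// -poweR_EFin.
    have HN0 : (0 <= Hp_norm p q X (step_distr h n h))%E.
      by apply: le_ereal_inf_tmp => _ [lam [a [_ ->]]]; exact: poweR_ge0.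
    apply: gt0_ler_poweR; rewrite ?in_itv /= ?leey ?andbT ?(ltW s0)//.
    exact: le_trans Hn.
  apply: le_trans (nneseries_lim_ge N.*2 _); last first.
    by move=> k _ _; rewrite lee_fin mulr_ge0 ?powR_ge0.
  (* Terms with k < N are discarded; the remaining N terms share one lower bound, whence the factor
     N. *)
  rewrite sumEFin lee_fin (@big_cat_nat _ _ _ N)//=; last by rewrite -addnn leq_addr.
  rewrite ler_wpDl//; first by apply: sumr_ge0 => k _; rewrite mulr_ge0 ?powR_ge0.
  rewrite -mulrA mulr_natl [X in _ *+ X](_ : N = (N.*2 - N)%N); last first.
    by rewrite -addnn addnK.
  by rewrite -sumr_const_nat; apply: ler_sum_nat => k /low.
pose sig := s * (n.+1%:R + b - p^-1).
pose h1 := c / n.+3%:R * 2 `^ (- (2 * gamma)).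
have h10 : 0 < h1 by rewrite mulr_gt0 ?divr_gt0 ?powR_gt0.
have hhE (N : nat) : hh N = h1 * N%:R `^ (- (2 * gamma)).
  by rewrite /hh /h1 -mul2n natrM powRM// mulrA.
pose Q := 2 `^ (- `|th|) * (m * kap) `^ s * h1 `^ sig.
have Q0 : 0 < Q by rewrite !mulr_gt0 ?powR_gt0 ?mulr_gt0.
(* [key] bounds N^eps by this quotient for every N >= 1, so an N beyond it is contradictory. *)
have [N N0] := powR_unbounded eps (`|C| * (2 ^+ n * n.+1%:R `^ p^-1) `^ s / Q) eps0.
rewrite (ltr_pdivrMr _ _ Q0) ltNge => /negP; apply.
have NR0 : 0 < N%:R :> R by rewrite ltr0n.
have D0 : 0 <= 2 ^+ n :> R := exprn_ge0 n (ler0n R 2).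
apply: (power_balance n.+1 s p^-1 gamma b th eps N%:R h1 (m * kap)
  (2 `^ (- `|th|)) `|C| (2 ^+ n) NR0 h10 (ltW (mulr_gt0 hm kap0)) D0).
  (* Since 2 gamma s (n + 1 + b - 1/p) = tau s + s/2 + gamma s - 2 gamma s / p, the terms in tau
     cancel and the rest is E up to eps. *)
  have g0 : gamma != 0 by rewrite gt_eqF.
  have p0 : p != 0 by rewrite gt_eqF.
  rewrite /th /E /b /n -[P.+2%:R]natr1; field.
  by rewrite g0 p0.
by rewrite -hhE -[m * kap * _]mulrA; exact: key.
Qed.
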